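(* Let $\rho$ be a quantum state with density matrix $[\rho_{m,n}]_{m,n\in\mathbb N}$. Suppose that there exists $B>0$ such that, for all $m\ge n$, $$|\rho_{m,n}|\le e^{-B(m+n)}.$$ Then there exists $z_0$ such that $z:=\sqrt{q^2+p^2}\ge z_0$ implies $$|W_\rho(q,p)|\le A(z)\,e^{-\frac{B}{(1+\sqrt B)^2}z^2}\qquad\text{and}\qquad |\widetilde W_\rho(q,p)|\le A(z/2)\,e^{-\frac{B}{(1+\sqrt B)^2}(z/2)^2},$$ where $$A(z)=\frac1\pi\left(\sum_{m,n\in\mathbb N}e^{-B(m+n)}+\frac{2e^{B}}{B(1+\sqrt B)^2}z^2\right).$$
   Context: Notation: $\mathbb N=\{0,1,2,\dots\}$. Fock basis of $L^2(\mathbb R)$: $h_m(x)=(2^m m!\sqrt\pi)^{-1/2}H_m(x)e^{-x^2/2}$, $H_m(x)=(-1)^m e^{x^2}\frac{d^m}{dx^m}e^{-x^2}$. A quantum state is a selfadjoint, positive, trace-one operator $\rho$ on $L^2(\mathbb R)$, with density matrix $\rho_{m,n}=\langle h_m,\rho h_n\rangle$. Its Wigner function is $W_\rho(q,p)=\sum_{m,n}\rho_{m,n}W_{m,n}(q,p)$ with $W_{m,n}(q,p)=\frac1\pi\int e^{2ipx}h_m(q-x)h_n(q+x)\,dx$, and its Fourier transform is $\widetilde W_\rho(u,v)=\iint e^{-i(uq+vp)}W_\rho(q,p)\,dq\,dp$. *)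

(* Defs.v *)
From HB Require Import structures.
From mathcomp Require Import all_boot all_order all_algebra.
From mathcomp Require Import all_classical all_reals all_analysis.
From mathcomp Require Export complex.
Set Implicit Arguments.
Unset Strict Implicit.
Unset Printing Implicit Defensive.
Import Order.TTheory GRing.Theory Num.Theory.
Import numFieldNormedType.Exports.
Local Open Scope classical_set_scope.
Local Open Scope ring_scope.
Local Open Scope complex_scope.

(* The R-valued projections, not the R[i]-valued 'Re and 'Im of
   numClosedFieldType. *)
Local Notation Re := complex.Re.
Local Notation Im := complex.Im.

Notation normc := complex.ComplexField.Normc.normc.

(* Wave functions are complex-valued functions on the line, and L^2(R) is the
   space of square-integrable ones up to a.e. equality for Lebesgue measure.
   The quotient is not formed: operators on L^2(R) are maps on representatives
   that respect a.e. equality, and all equations between elements of L^2(R) are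
   stated a.e. *)

Section ComplexAnalysis.
Context {R : realType}.

Definition cis (t : R) : R[i] := cos t +i* sin t.

Definition cintegral (d : measure_display) (T : measurableType d)
    (mu : {measure set T -> \bar R}) (f : T -> R[i]) : R[i] :=
  (\int[mu]_(x in setT) Re (f x)) +i* (\int[mu]_(x in setT) Im (f x)).

Definition climn (u : nat -> R[i]) : R[i] :=
  limn (fun n => Re (u n)) +i* limn (fun n => Im (u n)).

(* Sums over pairs of indices are limits of square partial sums.  For the
   Wigner series of a quantum state this limit always exists, even where the
   series is not absolutely convergent; it is the usual sum when it is. *)
Definition csum2 (a : nat -> nat -> R[i]) : R[i] :=
  climn (fun N => \sum_(m < N) \sum_(n < N) a m n).

End ComplexAnalysis.

Section SquareIntegrable.
Context {R : realType}.
Local Notation mu := (@lebesgue_measure R).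
Implicit Types f g : R -> R[i].

Definition isL2 f : Prop :=
  ((fun x => Re (f x)) \in Lfun mu 2%:E) /\
  ((fun x => Im (f x)) \in Lfun mu 2%:E).

Definition inner f g : R[i] := cintegral mu (fun x => conjc (f x) * g x).

Definition L2norm f : R := Num.sqrt (Re (inner f f)).

Record bounded_operator (T : (R -> R[i]) -> (R -> R[i])) : Prop := {
  operator_L2 : forall f, isL2 f -> isL2 (T f);
  operator_ae : forall f g, isL2 f -> isL2 g ->
    ae_eq mu setT f g -> ae_eq mu setT (T f) (T g);
  operator_linear : forall (a : R[i]) f g, isL2 f -> isL2 g ->
    ae_eq mu setT (T (fun x => a * f x + g x))
                  (fun x => a * T f x + T g x);
  operator_bounded : exists C : R, forall f, isL2 f ->
    L2norm (T f) <= C * L2norm f }.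

End SquareIntegrable.

Section QuantumState.
Context {R : realType}.
Local Notation mu := (@lebesgue_measure R).

Definition hermite (m : nat) (x : R) : R :=
  (-1) ^+ m * expR (x ^+ 2) * derive1n m (fun y : R => expR (- y ^+ 2)) x.

Definition fock (m : nat) (x : R) : R :=
  (Num.sqrt (2 ^+ m * m`!%:R * Num.sqrt pi))^-1
    * hermite m x * expR (- (x ^+ 2 / 2)).

Definition density (rho : (R -> R[i]) -> (R -> R[i])) (m n : nat) : R[i] :=
  inner (fun x => (fock m x)%:C) (rho (fun x => (fock n x)%:C)).

(* For a positive operator the trace is the sum of the (nonnegative) diagonal
   entries in an orthonormal basis, here the Fock basis; the operator is trace
   class exactly when this sum is finite. *)
Record quantum_state (rho : (R -> R[i]) -> (R -> R[i])) : Prop := {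
  state_operator : bounded_operator rho;
  state_selfadjoint : forall f g, isL2 f -> isL2 g ->
    inner f (rho g) = inner (rho f) g;
  state_positive : forall f, isL2 f -> 0 <= inner f (rho f);
  state_trace :
    (fun N => \sum_(n < N) Re (density rho n n)) @ \oo --> (1 : R) }.

Definition wigner_basis (m n : nat) (q p : R) : R[i] :=
  (pi^-1)%:C * cintegral mu
    (fun x => cis (2 * p * x) * (fock m (q - x) * fock n (q + x))%:C).

Definition wigner (rho : (R -> R[i]) -> (R -> R[i])) (q p : R) : R[i] :=
  csum2 (fun m n => density rho m n * wigner_basis m n q p).

Definition wigner_fourier (rho : (R -> R[i]) -> (R -> R[i])) (u v : R) : R[i] :=
  cintegral (mu \x mu)%E
    (fun z => cis (- (u * z.1 + v * z.2)) * wigner rho z.1 z.2).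

Definition wigner_prefactor (B z : R) : R :=
  pi^-1 * (fine (\esum_(k in [set: nat * nat])
                   (expR (- B * (k.1 + k.2)%:R))%:E)
           + 2 * expR B / (B * (1 + Num.sqrt B) ^+ 2) * z ^+ 2).

End QuantumState.

(* Main.v *)
From mathcomp Require Import zify.
Require Import Defs.
From mathcomp Require Import all_boot all_order all_algebra.
From mathcomp Require Import all_classical all_reals all_analysis.
From mathcomp Require Import measurable_realfun ring lra.
Import Order.TTheory GRing.Theory Num.Theory.

(** Why the theorem is true.  Let W_mn be the Wigner function of the matrix unit
    |m><n|, and put al = (q + i p) / sqrt 2, so that z^2 = 2 |al|^2.  The ladder
    relations of the Fock functions, multiplication and differentiation together
    with one integration by parts, become raising relations for W_mn.  These
    determine the family from its corner W_00, hence W_mn is W_00 times a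
    polynomial [ito m n al] defined by the same recursion
    ([wigner_amplitude_ito]), and W_00 is a Gaussian e^{-z^2} up to a constant
    ([wigner_basisE]).

    The estimate that is needed is exponential in both m + n and z^2: for
    0 < r < 1,
      |W_mn| <= C r^{-(m+n)/2} exp (- (1 - r) / (1 + r) z^2).
    It reflects that the sum of r^{m+n} |W_mn|^2 is the overlap of two displaced
    thermal states, an explicit Gaussian.  Here it is proved by a differential
    equation ([chain_bound], [ito_gaussian_bound]): along a ray from the origin,
    the sums of |ito m n|^2 over the levels m + n = k and their derivatives are
    both linear in one sequence of flows between consecutive levels; eliminating
    the flows leaves a first-order linear equation for the weighted sum over all
    levels.

    Take r = 1 / (1 + 2 B).  The rate in z^2 becomes B / (1 + B), which is larger
    than B / (1 + sqrt B)^2, and e^{-B} r^{-1/2} < 1, because 1 + 2 B < e^{2 B}.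
    Summing against the density matrix therefore gives |W| <= C e^{-B z^2 / (1 + B)},
    and for large z the surplus in the rate absorbs the constant C
    ([exp_prefactor_le]).

    The Fourier transform of W_mn satisfies the same raising relations, up to the
    sign (-1)^m, at the phase point rotated by a right angle and halved
    ([lower_hat], [wigner_hat_ito]): integration by parts over the plane replaces
    derivatives by frequencies.  Hence it obeys the same bound with z / 2 in place
    of z, and dominated convergence allows the double series to be integrated term
    by term ([wigner_fourier_decay]). *)

Set Implicit Arguments.
Unset Strict Implicit.
Unset Printing Implicit Defensive.
Import numFieldNormedType.Exports.
Local Open Scope classical_set_scope.
Local Open Scope ring_scope.
Local Open Scope complex_scope.

Local Notation Re := complex.Re.
Local Notation Im := complex.Im.

(** * Complex-valued functions of a real variable *)

Section ComplexDerivative.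
Variable R : realType.
Implicit Types (f g : R -> R[i]) (s : R) (l m a : R[i]).

Lemma sqr_normcE (z : R[i]) : normc z ^+ 2 = Re z ^+ 2 + Im z ^+ 2.
Proof. by case: z => x y /=; rewrite sqr_sqrtr ?addr_ge0 ?sqr_ge0. Qed.

Lemma normc_ge0 (z : R[i]) : 0 <= normc z.
Proof. by case: z => x y /=; exact: sqrtr_ge0. Qed.

Lemma normcR (x : R) : normc x%:C = `|x|.
Proof. by rewrite /= expr0n addr0 sqrtr_sqr. Qed.

Lemma normc_conj (z : R[i]) : normc (conjc z) = normc z.
Proof. by case: z => x y /=; rewrite sqrrN. Qed.

Lemma normcM (x y : R[i]) : normc (x * y) = normc x * normc y.
Proof. exact: complex.ComplexField.Normc.normcM. Qed.

Lemma normc_sum (I : Type) (r : seq I) (P : pred I) (F : I -> R[i]) :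
  normc (\sum_(i <- r | P i) F i) <= \sum_(i <- r | P i) normc (F i).
Proof.
elim/big_ind2: _ => [|x u y v hx hy|//].
  by rewrite complex.ComplexField.Normc.normc0.
by rewrite (le_trans (le_normcD _ _))// lerD.
Qed.

Lemma Re_le_normc (z : R[i]) : `|Re z| <= normc z.
Proof.
rewrite -(@ler_pXn2r _ 2) ?nnegrE ?normr_ge0 ?normc_ge0//.
by rewrite sqr_normcE real_normK ?num_real// lerDl sqr_ge0.
Qed.

Lemma Im_le_normc (z : R[i]) : `|Im z| <= normc z.
Proof.
rewrite -(@ler_pXn2r _ 2) ?nnegrE ?normr_ge0 ?normc_ge0//.
by rewrite sqr_normcE real_normK ?num_real// lerDr sqr_ge0.
Qed.

Lemma normc_le_ReIm (z : R[i]) : normc z <= `|Re z| + `|Im z|.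
Proof.
rewrite -(@ler_pXn2r _ 2) ?nnegrE ?addr_ge0 ?normr_ge0 ?normc_ge0//.
rewrite sqr_normcE sqrrD !real_normK ?num_real//.
rewrite -addrA (addrC (_ *+ 2)) addrA lerDl mulrn_wge0// mulr_ge0//.
Qed.

(** Differentiation is componentwise because the complex numbers carry here a
    topology over themselves, not over the reals. *)
Definition is_cderive f s l :=
  is_derive s 1 (fun x => Re (f x)) (Re l) /\
  is_derive s 1 (fun x => Im (f x)) (Im l).

Lemma is_cderive_eq f s l m : is_cderive f s l -> l = m -> is_cderive f s m.
Proof. by move=> h <-. Qed.

Lemma cReD (x y : R[i]) : Re (x + y) = Re x + Re y.
Proof. by case: x y => [? ?] []. Qed.
Lemma cImD (x y : R[i]) : Im (x + y) = Im x + Im y.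
Proof. by case: x y => [? ?] []. Qed.
Lemma cReM (x y : R[i]) : Re (x * y) = Re x * Re y - Im x * Im y.
Proof. by case: x y => [? ?] []. Qed.
Lemma cImM (x y : R[i]) : Im (x * y) = Re x * Im y + Im x * Re y.
Proof. by case: x y => [? ?] []. Qed.

Lemma is_cderive_cst l s : is_cderive (fun=> l) s 0.
Proof. by split; apply: is_derive_cst. Qed.

Lemma is_cderiveD f g s l m : is_cderive f s l -> is_cderive g s m ->
  is_cderive (fun x => f x + g x) s (l + m).
Proof.
move=> [f1 f2] [g1 g2]; split.
  under eq_fun do rewrite cReD; rewrite cReD; exact: is_deriveD.
under eq_fun do rewrite cImD; rewrite cImD; exact: is_deriveD.
Qed.

Lemma is_cderiveM f g s l m : is_cderive f s l -> is_cderive g s m ->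
  is_cderive (fun x => f x * g x) s (l * g s + f s * m).
Proof.
move=> [f1 f2] [g1 g2]; split.
  under eq_fun do rewrite cReM.
  apply: is_derive_eq; rewrite cReD !cReM; rewrite /GRing.scale/=; ring.
under eq_fun do rewrite cImM.
apply: is_derive_eq; rewrite cImD !cImM; rewrite /GRing.scale/=; ring.
Qed.

Lemma is_cderiveZ f s l a : is_cderive f s l ->
  is_cderive (fun x => a * f x) s (a * l).
Proof.
move=> h; apply: is_cderive_eq (is_cderiveM (is_cderive_cst a s) h) _.
by rewrite mul0r add0r.
Qed.

Lemma is_cderive_real (f : R -> R) s (l : R) : is_derive s 1 f l ->
  is_cderive (fun x => (f x)%:C) s l%:C.
Proof. by split => //=; exact: is_derive_cst. Qed.

Lemma ReJ (x : R[i]) : Re (conjc x) = Re x.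
Proof. by case: x. Qed.
Lemma ImJ (x : R[i]) : Im (conjc x) = - Im x.
Proof. by case: x. Qed.

Lemma is_cderive_conj f s l : is_cderive f s l ->
  is_cderive (fun x => conjc (f x)) s (conjc l).
Proof.
move=> [f1 f2]; split; first by under eq_fun do rewrite ReJ; rewrite ReJ.
by under eq_fun do rewrite ImJ; rewrite ImJ; exact: is_deriveN.
Qed.

Lemma is_cderive_line (a b : R[i]) s : is_cderive (fun x => a + x%:C * b) s b.
Proof.
apply: is_cderive_eq.
  apply: is_cderiveD; first exact: is_cderive_cst.
  apply: is_cderiveM; last exact: is_cderive_cst.
  apply: (@is_cderive_real id); exact: is_derive_id.
by rewrite /=; ring.
Qed.

Lemma is_cderive_sqr_normc f s l : is_cderive f s l ->
  is_derive s 1 (fun x => normc (f x) ^+ 2) (2 * Re (l * conjc (f s))).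
Proof.
move=> [f1 f2]; under eq_fun do rewrite sqr_normcE.
apply: is_derive_eq; rewrite cReM /GRing.scale/=; case: (f s) => ? ? /=; ring.
Qed.

End ComplexDerivative.

(** * Normalised Ito polynomials *)

Section Ito.
Variable R : realType.
Implicit Types (m n k : nat) (al a : R[i]).

(** The matrix elements of the ladder operators are square roots of integers.
    The index [m.-1] is used below without a side condition [0 < m], since
    [sqn 0 = 0] kills the term in which it is meaningless. *)
Definition sqn n : R[i] := (Num.sqrt (n%:R : R))%:C.

Lemma sqn0 : sqn 0 = 0. Proof. by rewrite /sqn sqrtr0. Qed.

Lemma sqn_sqr n : sqn n * sqn n = n%:R.
Proof.
by rewrite /sqn -rmorphM/= -expr2 sqr_sqrtr ?ler0n// rmorph_nat.
Qed.

Lemma sqn_sqrM n (x : R[i]) : sqn n * (sqn n * x) = n%:R * x.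
Proof. by rewrite mulrA sqn_sqr. Qed.

Lemma sqn_neq0 n : sqn n.+1 != 0.
Proof.
by rewrite /sqn eq_complex /= eqxx andbT gt_eqF// sqrtr_gt0 ltr0Sn.
Qed.

Lemma conj_sqn n : conjc (sqn n) = sqn n.
Proof. exact: conjc_real. Qed.

(** The complex Hermite polynomials of Ito, that is, Laguerre polynomials up to
    a monomial, normalised so that [ito m n al] is the matrix element of a
    displaced parity operator between Fock states, freed of its Gaussian
    factor.  The definition by raising [n] makes the raising relation in [n]
    hold by construction. *)
Fixpoint ito m n al : R[i] :=
  match n with
  | 0 => iteri m (fun j x => 2 * conjc al * x / sqn j.+1) 1
  | k.+1 => (2 * al * ito m k al - sqn m * ito m.-1 k al) / sqn n
  end.

Lemma ito00 al : ito 0 0 al = 1. Proof. by []. Qed.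

Lemma ito_up0 m al : sqn m.+1 * ito m.+1 0 al = 2 * conjc al * ito m 0 al.
Proof. by rewrite /= mulrCA mulfV ?mulr1// sqn_neq0. Qed.

Lemma ito_upr m n al :
  sqn n.+1 * ito m n.+1 al = 2 * al * ito m n al - sqn m * ito m.-1 n al.
Proof. by rewrite /= mulrCA mulfV ?mulr1// sqn_neq0. Qed.

(** The two raising operators commute: by induction on [n], both sides are
    expanded with the raising relation in [n] until only the relation at lower
    indices remains. *)
Lemma ito_upl m n al :
  sqn m.+1 * ito m.+1 n al = 2 * conjc al * ito m n al - sqn n * ito m n.-1 al.
Proof.
elim: n m => [|n IH] m; first by rewrite ito_up0 sqn0 mul0r subr0.
apply: (mulfI (sqn_neq0 n)).
transitivity (sqn m.+1 * (sqn n.+1 * ito m.+1 n.+1 al)); first by ring.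
rewrite ito_upr mulrBr [_.-1]/=.
have -> : sqn m.+1 * (2 * al * ito m.+1 n al) =
  2 * al * (sqn m.+1 * ito m.+1 n al) by ring.
rewrite IH mulrA sqn_sqr.
have -> : sqn n.+1 * (2 * conjc al * ito m n.+1 al -
    sqn n.+1 * ito m n.+1.-1 al) =
  2 * conjc al * (sqn n.+1 * ito m n.+1 al) - (sqn n.+1 * sqn n.+1) * ito m n al
  by rewrite /=; ring.
rewrite ito_upr sqn_sqr.
case: m => [|m].
  rewrite sqn0 !mul0r; case: n {IH} => [|n]; first by rewrite sqn0; ring.
  rewrite [_.-1]/=; have -> : 2 * al * (2 * conjc al * ito 0 n.+1 al -
     sqn n.+1 * ito 0 n al) = 2 * al * 2 * conjc al * ito 0 n.+1 al -
     sqn n.+1 * (2 * al * ito 0 n al - sqn 0 * ito 0.-1 n al).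
    by rewrite sqn0; ring.
  by rewrite -ito_upr sqn_sqrM; ring.
rewrite [m.+1.-1]/=.
have -> : 2 * conjc al * (2 * al * ito m.+1 n al - sqn m.+1 * ito m n al) =
  2 * conjc al * 2 * al * ito m.+1 n al -
  sqn m.+1 * (2 * conjc al * ito m n al - sqn n * ito m n.-1 al)
  - sqn m.+1 * sqn n * ito m n.-1 al by ring.
rewrite -(IH m) sqn_sqrM.
case: n {IH} => [|n]; first by rewrite sqn0; ring.
rewrite [_.-1]/=.
have -> : 2 * al * (2 * conjc al * ito m.+1 n.+1 al -
    sqn n.+1 * ito m.+1 n al) =
  2 * al * 2 * conjc al * ito m.+1 n.+1 al -
  sqn n.+1 * (2 * al * ito m.+1 n al - sqn m.+1 * ito m n al)
  - sqn m.+1 * sqn n.+1 * ito m n al by ring.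
rewrite -(ito_upr m.+1) sqn_sqrM; ring.
Qed.

(** The Appell property: the derivatives of [ito m n] in [al] and in its
    conjugate are multiples of [ito m n.-1] and [ito m.-1 n]; [a] is the velocity
    of the path [f]. *)
Lemma is_cderive_ito m n (f : R -> R[i]) s a : is_cderive f s a ->
  is_cderive (fun x => ito m n (f x)) s
   (2 * a * sqn n * ito m n.-1 (f s) + 2 * conjc a * sqn m * ito m.-1 n (f s)).
Proof.
move=> df.
have Dup0 k : is_cderive (fun x => ito k 0 (f x)) s
    (2 * conjc a * sqn k * ito k.-1 0 (f s)).
  elim: k => [|k IH].
    rewrite sqn0 mulr0 mul0r; exact: is_cderive_cst.
  have -> : (fun x => ito k.+1 0 (f x)) =
      (fun x => (2 / sqn k.+1) * (conjc (f x) * ito k 0 (f x))).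
    apply/funext => x; apply: (mulfI (sqn_neq0 k)); rewrite ito_up0.
    by field; exact: (sqn_neq0 k).
  apply: (is_cderive_eq
    (is_cderiveZ (2 / sqn k.+1) (is_cderiveM (is_cderive_conj df) IH))).
  rewrite [k.+1.-1]/=; apply: (mulfI (sqn_neq0 k)).
  set X := conjc a * _ + _.
  have -> : sqn k.+1 * (2 / sqn k.+1 * X) = 2 * X by field; exact: (sqn_neq0 k).
  rewrite {}/X.
  have -> : sqn k.+1 * (2 * conjc a * sqn k.+1 * ito k 0 (f s)) =
    2 * conjc a * (sqn k.+1 * sqn k.+1) * ito k 0 (f s) by ring.
  rewrite sqn_sqr; case: k {IH} => [|k]; first by rewrite sqn0; ring.
  have -> : 2 * (conjc a * ito k.+1 0 (f s) +
     conjc (f s) * (2 * conjc a * sqn k.+1 * ito k 0 (f s))) =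
     2 * conjc a * ito k.+1 0 (f s) +
     2 * conjc a * sqn k.+1 * (2 * conjc (f s) * ito k 0 (f s)) by ring.
  rewrite -ito_up0; have -> : 2 * conjc a * sqn k.+1 * (sqn k.+1 * ito k.+1 0 (f
      s)) = 2 * conjc a * (k.+1%:R * ito k.+1 0 (f s)).
    by rewrite -(sqn_sqrM k.+1); ring.
  rewrite -(natr1 k.+1); ring.
elim: n m => [|n IH] m.
  by rewrite sqn0 mulr0 mul0r add0r; exact: Dup0.
have -> : (fun x => ito m n.+1 (f x)) =
    (fun x => (2 / sqn n.+1) * (f x * ito m n (f x)) +
              (- sqn m / sqn n.+1) * ito m.-1 n (f x)).
  apply/funext => x; apply: (mulfI (sqn_neq0 n)); rewrite ito_upr.
  by field; exact: (sqn_neq0 n).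
apply: (is_cderive_eq (is_cderiveD
  (is_cderiveZ (2 / sqn n.+1) (is_cderiveM df (IH m)))
  (is_cderiveZ (- sqn m / sqn n.+1) (IH m.-1)))).
apply: (mulfI (sqn_neq0 n)); rewrite [n.+1.-1]/=.
have -> : sqn n.+1 * (2 * a * sqn n.+1 * ito m n (f s) +
   2 * conjc a * sqn m * ito m.-1 n.+1 (f s)) =
   2 * a * (sqn n.+1 * sqn n.+1) * ito m n (f s) +
   2 * conjc a * sqn m * (sqn n.+1 * ito m.-1 n.+1 (f s)) by ring.
rewrite ito_upr sqn_sqr.
set X := 2 * a * sqn n * _ + _; set Y := 2 * a * sqn n * _ + _.
have -> : sqn n.+1 * (2 / sqn n.+1 * (a * ito m n (f s) + f s * X) +
   - sqn m / sqn n.+1 * Y) = 2 * (a * ito m n (f s) + f s * X) - sqn m * Y.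
  by field; exact: (sqn_neq0 n).
rewrite {}/X {}/Y.
case: n {IH} => [|n].
  by rewrite sqn0; ring.
have E := ito_upr m n (f s).
have -> : 2 * a * n.+2%:R * ito m n.+1 (f s) = 2 * a * ito m n.+1 (f s) +
   2 * a * (sqn n.+1 * (sqn n.+1 * ito m n.+1 (f s))).
  by rewrite sqn_sqrM -(natr1 n.+1); ring.
rewrite E [n.+1.-1]/=; ring.
Qed.

End Ito.

#[global] Arguments sqn : simpl never.
#[global] Arguments ito : simpl never.

(** * Gaussian decay of the Ito polynomials *)

Section Chain.
Variable R : realType.

Lemma le_geometric_error (X D C x : R) (k : nat) : 0 <= x < 1 ->
  (forall K, (k <= K)%N -> X <= D + C * x ^+ K) -> X <= D.
Proof.
move=> /andP[x0 x1] H.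
have cv : (fun K => D + C * x ^+ K) @ \oo --> D + C * 0.
  apply: cvgD; first exact: cvg_cst.
  apply: cvgM; first exact: cvg_cst.
  by apply: cvg_expr; rewrite ger0_norm.
rewrite -[leRHS]addr0 -[X in _ + X](mulr0 C).
by apply: (cvgr_to_ge cv); exists k.
Qed.

Lemma is_derive_wsum (c : nat -> R) (Q dQ : nat -> R -> R) (s : R) K :
  (forall k, is_derive s 1 (Q k) (dQ k s)) ->
  is_derive s 1 (fun x => \sum_(k < K) c k * Q k x) (\sum_(k < K) c k * dQ k s).
Proof.
move=> dQs; elim: K => [|K IH].
  under eq_fun do rewrite big_ord0.
  by rewrite big_ord0; exact: is_derive_cst.
under eq_fun do rewrite big_ord_recr/=.
rewrite big_ord_recr/=; exact: is_deriveD.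
Qed.

Lemma is_derive_gauss (d s : R) :
  is_derive s 1 (fun x => expR (d * x ^+ 2)) (2 * d * s * expR (d * s ^+ 2)).
Proof.
apply: is_derive_eq.
rewrite /GRing.scale/=; ring.
Qed.

(** This is the analytic core.  With [F] the sum of [r ^+ k * Q k], the
    recursion for [Q] and its derivative turn into [F' = (16 r b s / (1 + r)) F]
    when the sums are infinite.  Truncating at [K] leaves a single boundary
    term [r ^+ K * T K], which is geometrically small, so the mean value
    theorem applied to [F] times the inverse Gaussian gives the bound up to an
    error that vanishes as [K] grows. *)
Lemma chain_bound (Q T : nat -> R -> R) (b r C x D : R) :
  0 < r < 1 -> 0 <= b -> 0 <= x -> r * x < 1 -> 0 <= C ->
  (forall k s, 0 <= Q k s) ->
  (forall s, T 0 s = 0) ->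
  (forall k s, 2 * s * b * Q k s = T k s + T k.+1 s) ->
  (forall k (s : R), is_derive s 1 (Q k) (8 * T k s)) ->
  (forall k (s : R), 0 <= s <= 1 -> `|T k s| <= C * x ^+ k) ->
  (forall K, \sum_(k < K) r ^+ k * Q k 0 <= D) ->
  forall k, r ^+ k * Q k 1 <= D * expR (8 * r / (1 + r) * b).
Proof.
move=> /andP[r0 r1] b0 x0 rx1 C0 Q0 T0 QT dQ Tb QD k.
have r1_gt0 : 0 < 1 + r by rewrite addr_gt0.
set d := - (8 * r / (1 + r) * b).
have d_le0 : d <= 0 by rewrite oppr_le0 mulr_ge0// divr_ge0// ?mulr_ge0// ltW.
rewrite -[X in expR X]opprK expRN -/d ler_pdivlMr ?expR_gt0//.
(* The truncation order K is free; it only has to exceed k. *)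
apply: (@le_geometric_error _ _ (8 * C) (r * x) k.+1).
  by rewrite rx1 mulr_ge0// ltW.
move=> K kK.
pose F s := \sum_(j < K) r ^+ j * Q j s.
have F_ge j s : (j < K)%N -> r ^+ j * Q j s <= F s.
  move=> jK; rewrite /F (bigD1 (Ordinal jK))//= lerDl sumr_ge0// => i _.
  by rewrite mulr_ge0// exprn_ge0// ltW.
have FS s : (1 + r) * \sum_(j < K) r ^+ j * T j s =
    2 * s * b * r * F s - r ^+ K * T K s.
  have -> : 2 * s * b * r * F s =
     \sum_(j < K) r ^+ j.+1 * T j.+1 s + \sum_(j < K) r ^+ j.+1 * T j s.
    rewrite -big_split/= /F mulr_sumr; apply: eq_bigr => i _.
    have -> : 2 * s * b * r * (r ^+ i * Q i s) =
       r ^+ i.+1 * (2 * s * b * Q i s) by rewrite exprS; ring.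
    by rewrite QT; ring.
  have -> : \sum_(j < K) r ^+ j.+1 * T j.+1 s =
      \sum_(j < K) r ^+ j * T j s + r ^+ K * T K s.
    transitivity (\sum_(j < K.+1) r ^+ j * T j s); last by rewrite big_ord_recr.
    by rewrite big_ord_recl/= T0 mulr0 add0r.
  have -> : \sum_(j < K) r ^+ j.+1 * T j s = r * \sum_(j < K) r ^+ j * T j s.
    by rewrite mulr_sumr; apply: eq_bigr => i _; rewrite exprS mulrA.
  ring.
have dF (s : R) : is_derive s 1 F
    (- 2 * d * s * F s - 8 / (1 + r) * (r ^+ K * T K s)).
  apply: (is_derive_eq (@is_derive_wsum (fun j => r ^+ j) Q
    (fun j u => 8 * T j u) s K (fun j => dQ j s))) => /=.
  have -> : \sum_(j < K) r ^+ j * (8 * T j s) =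
      8 / (1 + r) * ((1 + r) * \sum_(j < K) r ^+ j * T j s).
    rewrite mulrA divfK ?gt_eqF// mulr_sumr; apply: eq_bigr => i _; ring.
  by rewrite FS /d; field; rewrite gt_eqF.
pose dg (s : R) := - (8 / (1 + r) * (r ^+ K * T K s)) * expR (d * s ^+ 2).
have dFg (s : R) : is_derive s 1 (fun u => F u * expR (d * u ^+ 2)) (dg s).
  apply: is_derive_eq (is_deriveM (dF s) (is_derive_gauss d s)) _.
  rewrite /GRing.scale/= /dg; ring.
have [c] := @MVT_segment R (fun u => F u * expR (d * u ^+ 2)) dg 0 1 ler01
  (fun s _ => dFg s) (derivable_within_continuous (fun s _ => @ex_derive _ _ _ _ _
      _ _ (dFg s))).
rewrite in_itv/= => c01 E.
have E1 : F 1 * expR d = F 0 + dg c.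
  by move: E; rewrite expr1n expr0n/= !mulr0 expR0 !mulr1 subr0 mulr1 => <-; ring.
apply: (@le_trans _ _ (F 1 * expR d)).
  by rewrite ler_pM2r ?expR_gt0// F_ge.
rewrite E1 lerD ?QD// (le_trans (ler_norm _))// /dg normrM normrN [X in X * _]normrM.
rewrite [`|expR _|]ger0_norm ?expR_ge0// [`|r ^+ K * _|]normrM.
have e1 : expR (d * c ^+ 2) <= 1.
  by rewrite -expR0 ler_expR mulr_le0_ge0 ?sqr_ge0.
have e2 : `|8 / (1 + r)| <= 8.
  rewrite ger0_norm ?divr_ge0 ?(ltW r1_gt0)//.
  by rewrite ler_pdivrMr// ler_peMr// lerDl ltW.
have e3 : `|r ^+ K| * `|T K c| <= C * (r * x) ^+ K.
  rewrite ger0_norm ?exprn_ge0 ?(ltW r0)// exprMn mulrCA.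
  by rewrite ler_pM2l ?exprn_gt0// Tb.
rewrite -[leRHS]mulr1 ler_pM ?mulr_ge0 ?expR_ge0//.
by rewrite -[8 * C * _]mulrA ler_pM ?mulr_ge0.
Qed.

End Chain.

Section ItoBound.
Variable R : realType.
Implicit Types (m n k : nat) (al a : R[i]).

Lemma normc_sqn n : normc (sqn R n) = Num.sqrt n%:R.
Proof. by rewrite normcR ger0_norm ?sqrtr_ge0. Qed.

(** One step of the recursion, solved for the new term: [N] is the index that is
    raised and [j] the other one.  As [j <= N], the term two levels down enters
    with a factor at most 1. *)
Lemma ito_step_le (N x e y z b c : R) (j : R) :
  0 < N -> j <= N -> 0 <= x -> 0 <= e -> 0 <= b -> 0 <= c ->
  4 * x ^+ 2 <= e ^+ 2 * N ->
  y <= b -> (0 < j -> z <= c) ->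
  forall u, Num.sqrt N * u <= 2 * x * y + Num.sqrt j * z ->
  u <= e * b + c.
Proof.
move=> N0 jN x0 e0 b0 c0 xe yb zc u h.
rewrite -(@ler_pM2l _ (Num.sqrt N)) ?sqrtr_gt0// (le_trans h)//.
rewrite mulrDr mulrA lerD//.
  rewrite (@le_trans _ _ (2 * x * b))// ?ler_wpM2l ?mulr_ge0//.
  rewrite ler_wpM2r// -(@ler_pXn2r _ 2) ?nnegrE ?mulr_ge0 ?sqrtr_ge0//.
  by rewrite !exprMn sqr_sqrtr ?(ltW N0)// -natrX mulrC [_ * e ^+ 2]mulrC mulrC.
have [j0|j0] := lerP j 0.
  by rewrite ler0_sqrtr// mul0r mulr_ge0// sqrtr_ge0.
apply: (@le_trans _ _ (Num.sqrt j * c)).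
  by rewrite ler_wpM2l ?sqrtr_ge0// zc.
by rewrite ler_wpM2r// ler_wsqrtr.
Qed.

(** A crude a priori bound by levels [m + n].  Raising always the larger of the
    two indices keeps the coefficient of the term two levels down at most 1,
    whereas the coefficient of the previous level is of order
    [normc al / sqrt (m + n)]. *)
Lemma ito_growth (al : R[i]) (e beta : nat -> R) :
  1 <= beta 0 -> (forall k, 0 <= e k) ->
  (forall k, 8 * normc al ^+ 2 <= e k ^+ 2 * k.+1%:R) ->
  (forall k, (1 + e k) * beta k <= beta k.+1) ->
  forall m n, normc (ito m n al) <= beta (m + n)%N.
Proof.
move=> b0 e0 ea be.
have beta_ge0 k : 0 <= beta k.
  elim: k => [|k IH]; first exact: le_trans b0.
  by rewrite (le_trans _ (be k))// mulr_ge0// addr_ge0.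
have beta_le k : beta k <= beta k.+1.
  by rewrite (le_trans _ (be k))// ler_peMl// lerDl.
suff H k : (forall m n, (m + n)%N = k -> normc (ito m n al) <= beta k) /\
           (forall m n, (m + n)%N = k.+1 -> normc (ito m n al) <= beta k.+1).
  by move=> m n; apply: (H _).1.
have step p (b c : R) : 0 <= b -> 0 <= c -> e p * b + c <= beta p.+1 ->
    (forall m n, (m + n)%N = p -> normc (ito m n al) <= b) ->
    (forall m n, (m + n).+1 = p -> normc (ito m n al) <= c) ->
    forall m n, (m + n)%N = p.+1 -> normc (ito m n al) <= beta p.+1.
  move=> hb hc hp Hb Hc m n mn; apply: le_trans hp.
  have key i j (u z : R[i]) : (i.+1 + j = p.+1)%N -> (j <= i.+1)%N ->
     forall y, normc y <= b -> ((0 < j)%N -> normc z <= c) ->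
     (forall w : R[i], normc w = normc al ->
       sqn R i.+1 * u = 2 * w * y - sqn R j * z -> normc u <= e p * b + c).
    move=> ij ji y yb zc w wa E.
    apply: (@ito_step_le i.+1%:R (normc al) (e p) (normc y) (normc z) b c j%:R) => //.
    - by rewrite ler_nat.
    - exact: normc_ge0.
    - have := ea p; have : p.+1%:R <= 2 * i.+1%:R :> R.
        by rewrite -natrM ler_nat; lia.
      have := sqr_ge0 (e p); nra.
    - by rewrite ltr0n.
    - have := congr1 (@normc R) E; rewrite normcM normc_sqn => ->.
      rewrite (le_trans (le_normcD _ _))// normcN !normcM normc_sqn wa.
      by rewrite -[2]/(2%:R) -(rmorph_nat (real_complex R)) normcR ger0_norm.
  have [nm|mn'] := leqP n m.
    case: m mn nm => [|m] mn nm; first by move: mn nm; lia.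
    apply: (key m n _ (ito m n.-1 al) mn nm (ito m n al) _ _ (conjc al)).
    - by apply: Hb; lia.
    - by move=> n0; apply: Hc; lia.
    - exact: normc_conj.
    - exact: ito_upl.
  case: n mn mn' => [|n] mn mn'; first by move: mn mn'; lia.
  apply: (key n m _ (ito m.-1 n al) _ _ (ito m n al) _ _ al).
  - lia.
  - lia.
  - by apply: Hb; lia.
  - by move=> n0; apply: Hc; lia.
  - by [].
  - exact: ito_upr.
elim: k => [|k [IH1 IH2]].
  have H0 m n : (m + n)%N = 0 -> normc (ito m n al) <= beta 0.
    by case: m => //; case: n => //= _; rewrite expr1n expr0n addr0 sqrtr1.
  split => //; apply: (step 0 (beta 0) 0) => //.
  by rewrite addr0 (le_trans _ (be 0))// ler_wpM2r// lerDr.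
split => //; apply: (step k.+1 (beta k.+1) (beta k)) => //.
  by rewrite (le_trans _ (be _))// mulrDl mul1r addrC lerD2r.
by move=> m n [] mn; exact: IH1.
Qed.

Lemma ito0_le1 m n : normc (ito m n (0 : R[i])) <= 1.
Proof.
apply: (@ito_growth 0 (fun=> 0) (fun=> 1)) => // k.
by rewrite complex.ComplexField.Normc.normc0 !expr0n mulr0 mul0r.
Qed.

(** The coefficient in [ito_growth] tends to 0, so from some level [k0] on each
    level costs at most a factor [rho]; the finitely many levels below [k0] are
    absorbed in the constant. *)
Lemma ito_subexponential (A rho : R) : 0 <= A -> 1 < rho ->
  exists2 C : R, 0 <= C & forall al m n, normc al <= A ->
  normc (ito m n al) <= C * rho ^+ (m + n).
Proof.
move=> A0 rho1.
have rho0 : 0 < rho by apply: lt_trans rho1.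
pose L : R := 1 + 3 * A.
have L1 : 1 <= L by rewrite lerDl mulr_ge0.
have L0 : 0 <= L by apply: le_trans L1.
pose k0 := Num.truncn (8 * A ^+ 2 / (rho - 1) ^+ 2).
exists (L ^+ k0) => [|al m n alA]; first exact: exprn_ge0.
pose beta k := L ^+ minn k k0 * rho ^+ k.
apply: (@le_trans _ _ (beta (m + n)%N)); last first.
  by rewrite ler_wpM2r ?exprn_ge0 ?(ltW rho0)// ler_weXn2l// geq_minr.
pose e k := if (k < k0)%N then 3 * A else rho - 1.
have rho1_ge0 : 0 <= rho - 1 by rewrite subr_ge0 ltW.
have alA2 : normc al ^+ 2 <= A ^+ 2.
  by rewrite ler_pXn2r ?nnegrE// normc_ge0.
apply: (@ito_growth al e beta).
- by rewrite /beta min0n !expr0 mulr1.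
- by move=> k; rewrite /e; case: ifP => _ //; rewrite mulr_ge0.
- move=> k; apply: (@le_trans _ _ (8 * A ^+ 2)); first by rewrite ler_wpM2l.
  rewrite /e; case: ltnP => kk0.
    rewrite exprMn -natrX; have := sqr_ge0 A.
    have : 1 <= k.+1%:R :> R by rewrite ler1n.
    rewrite /=; nra.
  rewrite -ler_pdivrMl ?exprn_gt0 ?subr_gt0// mulrC.
  rewrite (le_trans (ltW (truncnS_gt _)))// ler_nat -/k0.
  by [].
- move=> k; rewrite /beta /e; case: ltnP => kk0.
    rewrite (minn_idPl kk0) -/L mulrA -exprS ler_wpM2l ?exprn_ge0//.
    by rewrite ler_weXn2l// ltW.
  rewrite (minn_idPr (leqW kk0)) exprS.
  by rewrite addrC subrK mulrCA.
Qed.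

End ItoBound.

Section ItoGaussian.
Variable R : realType.
Implicit Types (m n k : nat) (al a : R[i]).

Lemma sum_arith_geometric_le (r : R) K : 0 < r < 1 ->
  \sum_(k < K) r ^+ k * k.+1%:R <= (1 - r) ^- 2.
Proof.
move=> /andP[r0 r1]; have r1' : 0 < 1 - r by rewrite subr_gt0.
have E : (1 - r) ^+ 2 * \sum_(k < K) r ^+ k * k.+1%:R =
    1 - K.+1%:R * r ^+ K + K%:R * r ^+ K.+1.
  elim: K => [|K IH]; first by rewrite big_ord0 mulr0 expr0 mul0r addr0 mulr1 subrr.
  rewrite big_ord_recr/= mulrDr IH !exprS -(natr1 K.+1) -(natr1 K); ring.
rewrite -(@ler_pM2l _ ((1 - r) ^+ 2)) ?exprn_gt0// E mulfV ?expf_neq0 ?gt_eqF//.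
rewrite -addrA gerDl addrC subr_le0 exprS mulrA ler_wpM2r ?exprn_ge0 ?(ltW r0)//.
by rewrite -(natr1 K) -[leLHS]addr0 lerD// ler_piMr// ltW.
Qed.

Lemma natr_le_expr (d : R) k : 0 < d -> k.+1%:R <= (1 + d^-1) * (1 + d) ^+ k.
Proof.
move=> d0; elim: k => [|k IH].
  by rewrite expr0 mulr1 lerDl invr_ge0 ltW.
have p1 : 1 <= (1 + d) ^+ k by rewrite exprn_ege1// lerDl ltW.
rewrite -natr1 exprS (_ : _ * _ = (1 + d^-1) * (1 + d) ^+ k +
   (d + 1) * (1 + d) ^+ k); last by field; rewrite gt_eqF.
rewrite lerD//; nra.
Qed.

Section Levels.
Variable al : R[i].
Local Notation v m n s := (ito m n (s%:C * al)).

(** Multiplying a raising relation by the conjugate of [ito m n] and taking real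
    parts splits the squared modulus into flows between neighbouring sites of
    the lattice of indices, one for each direction of the lattice. *)
Definition flow_l m n (s : R) : R :=
  Re (conjc al * sqn R m * v m.-1 n s * conjc (v m n s)).
Definition flow_r m n (s : R) : R :=
  Re (al * sqn R n * v m n.-1 s * conjc (v m n s)).

Lemma mulJ_Re (z : R[i]) : Re (z * conjc z) = normc z ^+ 2.
Proof. by case: z => x y /=; rewrite sqr_sqrtr ?addr_ge0 ?sqr_ge0//; ring. Qed.

Lemma ReMr (x : R) (z : R[i]) : Re (x%:C * z) = x * Re z.
Proof. by case: z => ? ? /=; ring. Qed.

Lemma Re_swap (c q x y : R[i]) : conjc q = q ->
  Re (c * q * x * conjc y) = Re (conjc c * (q * y) * conjc x).
Proof.
by move=> qE; rewrite -ReJ !rmorphM/= conjcK qE; congr Re; ring.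
Qed.

Lemma flow_upr m n s : 2 * s * normc al ^+ 2 * normc (v m n s) ^+ 2 =
  flow_l m n s + flow_r m n.+1 s.
Proof.
rewrite -!mulJ_Re.
have -> : flow_r m n.+1 s = Re (conjc al * (sqn R n.+1 * v m n.+1 s) * conjc (v m n s)).
  exact: Re_swap (conj_sqn _ _).
rewrite ito_upr /flow_l -cReD.
rewrite (_ : _ + _ = (2 * s)%:C * ((normc al ^+ 2)%:C * (v m n s * conjc (v m n s)))).
  by rewrite !ReMr -mulJ_Re mulrA.
have -> : (normc al ^+ 2)%:C = al * conjc al.
  by rewrite -mulJ_Re; case: (al) => x y; apply/eqP; rewrite eq_complex/=;
      apply/andP; split; apply/eqP; ring.
rewrite rmorphM/= -[2%:C]/(real_complex R 2%:R) rmorph_nat; ring.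
Qed.

Lemma flow_upl m n s : 2 * s * normc al ^+ 2 * normc (v m n s) ^+ 2 =
  flow_l m.+1 n s + flow_r m n s.
Proof.
rewrite -!mulJ_Re.
have -> : flow_l m.+1 n s = Re (al * (sqn R m.+1 * v m.+1 n s) * conjc (v m n s)).
  by rewrite /flow_l (Re_swap _ _ _ (conj_sqn _ _)) conjcK.
rewrite ito_upl /flow_r -cReD.
rewrite (_ : _ + _ = (2 * s)%:C * ((normc al ^+ 2)%:C * (v m n s * conjc (v m n s)))).
  by rewrite !ReMr -mulJ_Re mulrA.
have -> : (normc al ^+ 2)%:C = al * conjc al.
  by rewrite -mulJ_Re; case: (al) => x y; apply/eqP; rewrite eq_complex/=;
      apply/andP; split; apply/eqP; ring.
rewrite [(2 * s)%:C]rmorphM/= -[2%:C]/(real_complex R 2%:R) rmorph_nat.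
have -> : conjc (s%:C * al) = s%:C * conjc al by rewrite rmorphM/= oppr0.
ring.
Qed.

Definition level k s := \sum_(i < k.+1) normc (v i (k - i) s) ^+ 2.
Definition flow k s := \sum_(i < k.+1) flow_l i (k - i) s.

Lemma flow_l0 n s : flow_l 0 n s = 0.
Proof. by rewrite /flow_l sqn0 mulr0 !mul0r. Qed.
Lemma flow_r0 m s : flow_r m 0 s = 0.
Proof. by rewrite /flow_r sqn0 mulr0 !mul0r. Qed.

Lemma flow_shiftl k s : \sum_(i < k.+1) flow_l i.+1 (k - i) s = flow k.+1 s.
Proof.
by rewrite /flow [RHS]big_ord_recl/= flow_l0 add0r; apply: eq_bigr => i _.
Qed.

Lemma flow_shiftr k s : \sum_(i < k.+1) flow_r i (k - i).+1 s =
  \sum_(i < k.+2) flow_r i (k.+1 - i) s.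
Proof.
rewrite [RHS]big_ord_recr/= subnn flow_r0 addr0; apply: eq_bigr => i _.
by rewrite subSn// -ltnS.
Qed.

(** Summed over a level, the flows in the two directions agree: both
    expressions for the squared moduli of a level give the same difference of
    consecutive level sums, and the flows vanish at level 0. *)
Lemma flow_lr k s : \sum_(i < k.+1) flow_r i (k - i) s = flow k s.
Proof.
elim: k => [|k IH].
  by rewrite /flow !big_ord_recl !big_ord0/= flow_l0 flow_r0.
rewrite -flow_shiftr -flow_shiftl.
apply: (@addrI _ (flow k s)); rewrite -{2}IH /flow -!big_split/=.
by apply: eq_bigr => i _; rewrite -flow_upr flow_upl addrC.
Qed.

(** The first of the two relations that feed [chain_bound]. *)
Lemma level_flow k s :
  2 * s * normc al ^+ 2 * level k s = flow k s + flow k.+1 s.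
Proof.
rewrite mulr_sumr -flow_shiftl -flow_lr -big_split/=; apply: eq_bigr => i _.
by rewrite flow_upl addrC.
Qed.

(** The second of the two relations that feed [chain_bound]. *)
Lemma is_derive_level k (s : R) : is_derive s 1 (level k) (8 * flow k s).
Proof.
have -> : 8 * flow k s = \sum_(i < k.+1) 1 * (4 * (flow_l i (k - i) s + flow_r i (k
    - i) s)).
  under eq_bigr do rewrite mul1r.
  rewrite -mulr_sumr big_split/= flow_lr -/(flow k s); ring.
have -> : level k = (fun u => \sum_(i < k.+1) 1 * normc (v i (k - i) u) ^+ 2).
  by apply/funext => u; apply: eq_bigr => i _; rewrite mul1r.
apply: (@is_derive_wsum _ (fun=> 1) (fun i u => normc (v i (k - i) u) ^+ 2)
  (fun i u => 4 * (flow_l i (k - i) u + flow_r i (k - i) u))) => i.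
have dl : is_cderive (fun u => u%:C * al) s al.
  by have := is_cderive_line 0 al s; under eq_fun do rewrite add0r.
apply: is_derive_eq (is_cderive_sqr_normc (is_cderive_ito i (k - i) dl)) _.
rewrite /flow_l /flow_r -cReD -[in RHS](ReMr 4) -[LHS](ReMr 2); congr Re.
rewrite -[4%:C]/(real_complex R 4%:R) -[2%:C]/(real_complex R 2%:R) !rmorph_nat; ring.
Qed.

End Levels.

Lemma level_ge0 al k s : 0 <= level al k s.
Proof. by rewrite sumr_ge0// => i _; rewrite sqr_ge0. Qed.

Lemma flow0 al s : flow al 0 s = 0.
Proof. by rewrite /flow big_ord_recl big_ord0 flow_l0 addr0. Qed.

(** Polynomial factors in the level are absorbed by powers of [rho]. *)
Lemma flow_bound al (rho : R) : 1 < rho -> exists2 C : R, 0 <= C &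
  forall k (s : R), 0 <= s <= 1 -> `|flow al k s| <= C * (rho ^+ 4) ^+ k.
Proof.
move=> rho1; have rho0 : 0 < rho by apply: lt_trans rho1.
have [C C0 HC] := ito_subexponential (normc_ge0 al) rho1.
pose D := 1 + (rho - 1)^-1.
have D0 : 0 <= D by rewrite addr_ge0// invr_ge0 subr_ge0 ltW.
exists (normc al * D ^+ 2 * C ^+ 2).
  by rewrite !mulr_ge0 ?normc_ge0 ?exprn_ge0.
move=> k s /andP[s0 s1].
have kD : k.+1%:R <= D * rho ^+ k :> R.
  have := @natr_le_expr (rho - 1) k; rewrite subr_gt0 => /(_ rho1).
  by rewrite [1 + (rho - 1)]addrC subrK.
have vle i j : (i + j <= k)%N -> normc (ito i j (s%:C * al)) <= C * rho ^+ k.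
  move=> ijk; rewrite (le_trans (HC _ _ _ _))//.
    by rewrite normcM normcR ger0_norm// ler_piMl// normc_ge0.
  by rewrite ler_wpM2l// ler_weXn2l// ltW.
have Crk : 0 <= C * rho ^+ k by rewrite mulr_ge0// exprn_ge0// ltW.
have Ule (i : 'I_k.+1) : `|flow_l al i (k - i) s| <=
    normc al * k.+1%:R * (C * rho ^+ k) ^+ 2.
  have ik : (i <= k)%N by rewrite -ltnS.
  rewrite (le_trans (Re_le_normc _))// !normcM !normc_conj normc_sqn -mulrA expr2.
  rewrite ler_pM ?mulr_ge0 ?normc_ge0 ?sqrtr_ge0//.
    rewrite ler_wpM2l ?normc_ge0// -(@ler_pXn2r _ 2) ?nnegrE ?sqrtr_ge0//.
    rewrite sqr_sqrtr// -natrX ler_nat (leq_trans ik)// (leq_trans (leqnSn k))//.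
    by rewrite -[leqLHS]muln1 leq_mul.
  by rewrite ler_pM ?normc_ge0// vle//; lia.
rewrite (le_trans (ler_norm_sum _ _ _))// (le_trans (ler_sum _ (fun i _ => Ule i)))//.
rewrite sumr_const card_ord -[leLHS]mulr_natr.
have -> : normc al * k.+1%:R * (C * rho ^+ k) ^+ 2 * k.+1%:R =
  (normc al * C ^+ 2 * (rho ^+ k) ^+ 2) * k.+1%:R ^+ 2 by ring.
have -> : normc al * D ^+ 2 * C ^+ 2 * (rho ^+ 4) ^+ k =
  (normc al * C ^+ 2 * (rho ^+ k) ^+ 2) * (D * rho ^+ k) ^+ 2.
  by rewrite -exprM mulnC exprM; ring.
apply: ler_wpM2l; first by rewrite !mulr_ge0 ?normc_ge0 ?exprn_ge0 ?(ltW rho0).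
by rewrite ler_pXn2r ?nnegrE// (le_trans _ kD).
Qed.

(** The sharp exponential rate: summed over all [m] and [n], the left-hand side
    is the Hilbert-Schmidt overlap of a displaced thermal state with a thermal
    state, an explicit Gaussian in [al].  Only the bound on a single term is
    kept. *)
Theorem ito_gaussian_bound (r : R) al m n : 0 < r < 1 ->
  r ^+ (m + n) * normc (ito m n al) ^+ 2 <=
  (1 - r) ^- 2 * expR (8 * r / (1 + r) * normc al ^+ 2).
Proof.
move=> r01; have /andP[r0 r1] := r01.
(* The growth factor rho is chosen with r * rho ^+ 4 = sqrt r < 1. *)
pose x := Num.sqrt r^-1; pose rho := Num.sqrt (Num.sqrt x).
have sqrt_gt1 (y : R) : 1 < y -> 1 < Num.sqrt y.
  by move=> y1; rewrite -[ltLHS]sqrtr1 ltr_sqrt// (lt_trans _ y1).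
have rho1 : 1 < rho by rewrite !sqrt_gt1 ?invf_gt1.
have rho4 : rho ^+ 4 = x.
  rewrite (exprM rho 2 2) sqr_sqrtr ?sqrtr_ge0// sqr_sqrtr ?sqrtr_ge0//.
have [C C0 HC] := flow_bound al rho1.
have rx : r * rho ^+ 4 < 1.
  have xE : x ^+ 2 = r^-1 by rewrite sqr_sqrtr// invr_ge0 ltW.
  rewrite rho4 -(@ltr_pXn2r _ 2) ?nnegrE ?mulr_ge0 ?sqrtr_ge0 ?(ltW r0)//.
  by rewrite exprMn xE expr1n expr2 -mulrA mulfV ?gt_eqF// mulr1.
have H := @chain_bound R (level al) (flow al) (normc al ^+ 2) r C (rho ^+ 4)
  ((1 - r) ^- 2) r01 (sqr_ge0 _) (exprn_ge0 _ (sqrtr_ge0 _)) rx C0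
  (level_ge0 al) (flow0 al) (level_flow al) (is_derive_level al) HC _ (m + n)%N.
apply: le_trans (H _).
  rewrite ler_wpM2l ?exprn_ge0 ?(ltW r0)//.
  have mk : (m < (m + n).+1)%N by lia.
  rewrite /level (bigD1 (Ordinal mk))//= addKn mul1r.
  by rewrite lerDl sumr_ge0// => i _; rewrite sqr_ge0.
move=> K; apply: le_trans (sum_arith_geometric_le K r01).
apply: ler_sum => i _; rewrite ler_wpM2l ?exprn_ge0 ?(ltW r0)//.
have -> : (nat_of_ord i).+1%:R = \sum_(j < i.+1) (1 : R).
  by rewrite sumr_const card_ord.
apply: ler_sum => j _; rewrite mul0r -(expr1n _ 2) ler_pXn2r ?nnegrE ?normc_ge0//.
exact: ito0_le1.
Qed.

End ItoGaussian.

(** * Ladder relations of the Fock functions *)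

Section Fock.
Variable R : realType.
Implicit Types (m n k : nat) (x : R).

Local Notation g := (fun y : R => expR (- y ^+ 2)).
Local Notation G := (fun m => derive1n m g).

Lemma derive1_is_derive (f : R -> R) (df : R -> R) :
  (forall x, is_derive x 1 f (df x)) -> derive1 f = df.
Proof.
move=> d; apply/funext => x.
by rewrite derive1E (@derive_val _ _ _ _ _ _ _ (d x)).
Qed.

(** The second clause carries the factor [m%:R] so that it also makes sense for
    [m = 0], where [m.-1] is not a predecessor. *)
Lemma derive1n_gauss m :
  [/\ forall x, is_derive x 1 (G m) (G m.+1 x),
      forall x, is_derive x 1 (fun y => m%:R * G m.-1 y) (m%:R * G m x) &
      forall x, G m.+1 x = - (2 * x) * G m x - 2 * (m%:R * G m.-1 x)].
Proof.
have id2 x : is_derive x 1 (fun y : R => - (2 * y)) (- 2).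
  by apply: is_derive_eq; rewrite /GRing.scale/= mulr1.
elim: m => [|m [A A' B]].
  have d x : is_derive x 1 g (- (2 * x) * g x).
    have := is_derive_gauss (-1) x; under eq_fun do rewrite mulN1r.
    by move=> h; apply: is_derive_eq h _; rewrite mulN1r; ring.
  have E x : G 1 x = - (2 * x) * g x.
    by rewrite derive1n1 (derive1_is_derive d).
  split => x; first by apply: is_derive_eq (d x) _; rewrite E.
    rewrite mul0r (_ : (fun y => _) = cst 0); first exact: is_derive_cst.
    by apply/funext => y; rewrite mul0r.
  by rewrite E mul0r mulr0 subr0.
have d x : is_derive x 1 (G m.+1)
    (- (2 * x) * G m.+1 x - 2 * (m.+1%:R * G m x)).
  have h := is_deriveB (is_deriveM (id2 x) (A x)) (is_deriveZ 2 (A' x)).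
  rewrite (_ : _ - _ = G m.+1) in h; last by apply/funext => y; rewrite B.
  by apply: (is_derive_eq h); rewrite /GRing.scale/= -(natr1 m); ring.
have E x : G m.+2 x = - (2 * x) * G m.+1 x - 2 * (m.+1%:R * G m x).
  by rewrite derive1nS (derive1_is_derive d).
split; last exact: E.
  by move=> x; rewrite E; exact: d.
move=> x; exact: is_deriveZ (A x).
Qed.

Lemma hermite0 x : hermite 0 x = 1.
Proof. by rewrite /hermite derive1n0 expr0 mul1r -expRD addrN expR0. Qed.

Lemma hermiteS m x :
  hermite m.+1 x = 2 * x * hermite m x - 2 * (m%:R * hermite m.-1 x).
Proof.
have [_ _ E] := derive1n_gauss m.
rewrite /hermite E; case: m {E} => [|m]; first by rewrite !expr1 !mul0r expr0; ring.
by rewrite [m.+1.-1]/= !exprS; ring.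
Qed.

Lemma is_derive_hermite m x :
  is_derive x 1 (hermite m) (2 * (m%:R * hermite m.-1 x)).
Proof.
have [A _ B] := derive1n_gauss m.
have d1 : is_derive x 1 (fun y : R => (-1) ^+ m * expR (y ^+ 2))
    ((-1) ^+ m * (2 * x * expR (x ^+ 2))).
  have := is_derive_gauss 1 x; under eq_fun do rewrite mul1r; rewrite mulr1 mul1r.
  by move=> h; exact: is_deriveZ h.
apply: (is_derive_eq (is_deriveM d1 (A x))).
rewrite B /GRing.scale/= /hermite; case: m {A B d1} => [|m]; first by rewrite
    !mul0r; ring.
by rewrite [m.+1.-1]/= exprS; ring.
Qed.

Definition fock_norm m : R := (Num.sqrt (2 ^+ m * m`!%:R * Num.sqrt pi))^-1.

Lemma sqrt2_gt0 : 0 < Num.sqrt 2 :> R. Proof. by rewrite sqrtr_gt0. Qed.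

Lemma fock_normS m : fock_norm m = fock_norm m.+1 * Num.sqrt 2 * Num.sqrt m.+1%:R.
Proof.
rewrite /fock_norm factS natrM exprS.
have -> : 2 * 2 ^+ m * (m.+1%:R * m`!%:R) * Num.sqrt pi =
  (2 ^+ m * m`!%:R * Num.sqrt pi) * (2 * m.+1%:R) :> R by ring.
set A := _ * Num.sqrt pi.
have A0 : 0 < A by rewrite !mulr_gt0 ?exprn_gt0 ?ltr0n ?fact_gt0 ?sqrtr_gt0 ?pi_gt0.
move: A A0 => A A0; rewrite (sqrtrM _ (ltW A0)) sqrtrM//; field.
by rewrite !gt_eqF ?sqrtr_gt0.
Qed.

Lemma fockE m x : fock m x = fock_norm m * (hermite m x * expR (- (x ^+ 2 / 2))).
Proof. by rewrite /fock mulrA. Qed.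

Lemma sqr_sqrt2 : Num.sqrt 2 * Num.sqrt 2 = 2 :> R.
Proof. by rewrite -expr2 sqr_sqrtr. Qed.

Lemma sqr_sqrtn n : Num.sqrt n%:R * Num.sqrt n%:R = n%:R :> R.
Proof. by rewrite -expr2 sqr_sqrtr. Qed.

Lemma fock_norm_pred m :
  m%:R * fock_norm m * Num.sqrt 2 = Num.sqrt m%:R * fock_norm m.-1.
Proof.
case: m => [|m]; first by rewrite sqrtr0 !mul0r.
by rewrite [m.+1.-1]/= (fock_normS m) -{1}(sqr_sqrtn m.+1); ring.
Qed.

Lemma fock_up m x : Num.sqrt m.+1%:R * fock m.+1 x =
  Num.sqrt 2 * x * fock m x - Num.sqrt m%:R * fock m.-1 x.
Proof.
rewrite !fockE hermiteS.
have -> : Num.sqrt 2 * x * (fock_norm m * (hermite m x * expR (- (x ^+ 2 / 2)))) =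
  fock_norm m.+1 * (Num.sqrt 2 * Num.sqrt 2) * Num.sqrt m.+1%:R * x *
     (hermite m x * expR (- (x ^+ 2 / 2))) by rewrite (fock_normS m); ring.
rewrite sqr_sqrt2.
rewrite [X in _ = _ - X](_ : _ = Num.sqrt m.+1%:R * fock_norm m.+1 * (Num.sqrt 2 *
    Num.sqrt 2) *
   (m%:R * hermite m.-1 x * expR (- (x ^+ 2 / 2)))).
  by rewrite sqr_sqrt2; ring.
by rewrite [LHS]mulrA -fock_norm_pred (fock_normS m); ring.
Qed.

Lemma is_derive_fock m x : is_derive x 1 (fock m)
  (Num.sqrt 2 * Num.sqrt m%:R * fock m.-1 x - x * fock m x).
Proof.
have dg : is_derive x 1 (fun y => expR (- (y ^+ 2 / 2))) (- x * expR (- (x ^+ 2 / 2))).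
  have := is_derive_gauss (- 2^-1) x.
  under eq_fun do rewrite mulNr mulrC; rewrite mulNr (mulrC 2^-1).
  by move=> h; apply: (is_derive_eq h); field.
have h := is_deriveZ (fock_norm m) (is_deriveM (is_derive_hermite m x) dg).
rewrite (_ : _ \*: _ = fock m) in h; last first.
  by apply/funext => y; rewrite fockE.
apply: (is_derive_eq h); rewrite /GRing.scale/= !fockE.
have -> : Num.sqrt 2 * Num.sqrt m%:R * (fock_norm m.-1 * (hermite m.-1 x * expR (-
    (x ^+ 2 / 2)))) =
  (Num.sqrt 2 * Num.sqrt 2) * m%:R * fock_norm m * (hermite m.-1 x * expR (- (x ^+
      2 / 2))).
  transitivity (Num.sqrt 2 * (Num.sqrt m%:R * fock_norm m.-1) *
    (hermite m.-1 x * expR (- (x ^+ 2 / 2)))); first by ring.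
  by rewrite -fock_norm_pred; ring.
rewrite sqr_sqrt2; ring.
Qed.

Lemma normr_le_gauss (e x : R) : 0 < e <= 1 -> `|x| <= e^-1 * expR (e * x ^+ 2).
Proof.
move=> /andP[e0 e1].
rewrite ler_pdivlMl// (le_trans _ (expR_ge1Dx _))//.
rewrite -[x ^+ 2]real_normK ?num_real//; have := normr_ge0 x.
set y := `|x|; move=> y0; have := sqr_ge0 (1 - y); nra.
Qed.

(** Multiplication by [x], through the recursion, costs an arbitrarily small part
    of the Gaussian rate; [d'] is the rate halfway to the supremum 1/2. *)
Lemma fock_gauss_bound m (d : R) : 0 < d < 2^-1 ->
  exists2 C : R, 0 <= C & forall x, `|fock m x| <= C * expR (- (d * x ^+ 2)).
Proof.
suff H : forall d, 0 < d < 2^-1 ->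
  (exists2 C : R, 0 <= C & forall x, `|fock m x| <= C * expR (- (d * x ^+ 2))) /\
  (exists2 C : R, 0 <= C & forall x, `|fock m.-1 x| <= C * expR (- (d * x ^+ 2))).
  by move=> /H[].
elim: m => [|m IH] {}d /andP[d0 d2].
  suff H : exists2 C : R, 0 <= C & forall x, `|fock 0 x| <= C * expR (- (d * x ^+
      2)) by [].
  exists `|fock_norm 0| => // x.
  rewrite fockE hermite0 mul1r normrM ler_wpM2l// ger0_norm ?expR_ge0// ler_expR.
  by have := sqr_ge0 x; nra.
pose d' := (d + 2^-1) / 2.
have d'P : 0 < d' < 2^-1 by rewrite /d'; lra.
have d'd : d < d' by rewrite /d'; lra.
have [[C C0 HC] _] := IH _ d'P.
have [[C1 C10 HC1] [C2 C20 HC2]] : _ /\ _ := IH d (introT andP (conj d0 d2)).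
split; last by exists C1.
have sm : 0 < Num.sqrt m.+1%:R :> R by rewrite sqrtr_gt0.
exists ((Num.sqrt m.+1%:R)^-1 * (Num.sqrt 2 * (d' - d)^-1 * C + Num.sqrt m%:R * C2)).
  rewrite mulr_ge0 ?invr_ge0 ?(ltW sm)// addr_ge0 ?mulr_ge0 ?sqrtr_ge0//.
  by rewrite invr_ge0 subr_ge0 ltW.
move=> x; rewrite -[leRHS]mulrA ler_pdivlMl//.
rewrite -[X in X * `|_|]ger0_norm ?(ltW sm)// -normrM fock_up.
move: (fock m x) (fock m.-1 x) (HC x) (HC2 x) => fm fp hm hp.
rewrite (le_trans (ler_normB _ _))// mulrDl !normrM !(ger0_norm (sqrtr_ge0 _)).
apply: lerD; last by rewrite -[leRHS]mulrA ler_wpM2l ?sqrtr_ge0.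
have xb : `|x| <= (d' - d)^-1 * expR ((d' - d) * x ^+ 2).
  by apply: normr_le_gauss; rewrite subr_gt0 d'd/= /d'; lra.
apply: (@le_trans _ _ (Num.sqrt 2 * ((d' - d)^-1 * expR ((d' - d) * x ^+ 2)) *
   (C * expR (- (d' * x ^+ 2))))).
  by rewrite ler_pM ?mulr_ge0 ?sqrtr_ge0// ler_wpM2l ?sqrtr_ge0.
rewrite le_eqVlt; apply/orP; left; apply/eqP.
have -> : - (d * x ^+ 2) = (d' - d) * x ^+ 2 + (- (d' * x ^+ 2)) by ring.
by rewrite expRD; ring.
Qed.

End Fock.

(** * Integrals of Gaussian-dominated functions on the line *)

Section RealLine.
Variable R : realType.
Local Notation mu := (@lebesgue_measure R).

Lemma integrable_gauss (d : R) : 0 < d ->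
  mu.-integrable setT (EFin \o (fun x => expR (- (d * x ^+ 2)))).
Proof.
move=> d0.
pose s := Num.sqrt ((2 * d)^-1).
have s2 : s ^+ 2 = (2 * d)^-1 by rewrite sqr_sqrtr// invr_ge0 mulr_ge0// ltW.
have s0 : 0 < s by rewrite sqrtr_gt0 invr_gt0 mulr_gt0.
have p0 := normal_peak_gt0 (lt0r_neq0 s0).
have := integrableZl measurableT (normal_peak s)^-1 (integrable_normal_pdf 0 s).
apply: eq_integrable => // x _.
rewrite normal_pdfE ?gt_eqF// -EFinM mulKf ?gt_eqF//.
rewrite /normal_fun subr0 s2 /=; congr (expR _)%:E; field.
by rewrite gt_eqF.
Qed.

(** Integration by parts without boundary terms: the integral over [-n, n] is
    [f n - f (- n)] by the fundamental theorem of calculus, and dominated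
    convergence removes the truncation. *)
Lemma integral_derive_eq0 (f df : R -> R) (C d : R) : 0 < d ->
  (forall x : R, is_derive x 1 f (df x)) -> continuous df ->
  mu.-integrable setT (EFin \o df) ->
  (forall x, `|f x| <= C * expR (- (d * x ^+ 2))) ->
  (\int[mu]_x df x)%R = 0.
Proof.
move=> d0 fdf cdf idf fC.
pose F (n : nat) := (df \_ `[- n%:R, n%:R]%classic : R -> R).
have mdf : measurable_fun setT df by exact:
    measurable_realfun.continuous_measurable_fun.
have mF n : measurable_fun setT (fun x : R => (F n x)%:E).
  apply/measurable_EFinP; rewrite /F.
  exact: (measurable_restrictT df (measurable_itv `[- n%:R, n%:R])).1
    (measurable_funTS mdf).
have FE n : (\int[mu]_x (F n.+1 x)%:E = (f n.+1%:R - f (- n.+1%:R))%:E)%E.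
  have -> : (\int[mu]_x (F n.+1 x)%:E =
      \int[mu]_(x in `[(- n.+1%:R)%R, n.+1%:R%R]) (df x)%:E)%E.
    by rewrite [RHS]integral_mkcond restrict_EFin.
  rewrite (@continuous_FTC2 _ df f) ?EFinB//.
  - by apply: (@lt_trans _ _ 0); rewrite ?oppr_lt0 ltr0n.
  - exact: continuous_subspaceT.
  - split.
    + by move=> x _; exact: (@ex_derive _ _ _ _ _ _ _ (fdf x)).
    + apply: cvg_at_right_filter; apply: differentiable_continuous.
      by apply/derivable1_diffP; exact: (@ex_derive _ _ _ _ _ _ _ (fdf _)).
    + apply: cvg_at_left_filter; apply: differentiable_continuous.
      by apply/derivable1_diffP; exact: (@ex_derive _ _ _ _ _ _ _ (fdf _)).
  - by move=> x _; rewrite (derive1_is_derive fdf).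
have Fdf x : (F n.+1 x)%:E @[n --> \oo] --> (df x)%:E.
  apply: cvg_near_cst; exists (Num.truncn `|x|) => // n /= xn.
  congr EFin; rewrite /F patchE mem_set//= in_itv/= -ler_norml.
  by rewrite (le_trans (ltW (truncnS_gt _)))// ler_nat ltnS.
have Fle x n : (`|(F n.+1 x)%:E| <= (abse \o (EFin \o df)) x)%E.
  rewrite /F /= patchE; case: ifP => _; first exact: lexx.
  by rewrite normr0 lee_fin.
have H : (\int[mu]_x (F n.+1 x)%:E)%E @[n --> \oo] --> (\int[mu]_x (df x)%:E)%E.
  have [| | | |_ _] := @dominated_convergence _ _ _ mu setT measurableT
    (fun n x => (F n.+1 x)%:E) (EFin \o df)
    (abse \o (EFin \o df)) (fun n => mF n.+1).
  - exact/measurable_EFinP.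
  - by apply: aeW => x _; exact: Fdf.
  - exact: integrable_abse.
  - by apply: aeW => x n _; exact: Fle.
  - by [].
have C0 : 0 <= C.
  by have := le_trans (normr_ge0 _) (fC 0); rewrite pmulr_lge0 ?expR_gt0.
have f0 (t : R) (n : nat) : t ^+ 2 = n.+1%:R ^+ 2 -> `|f t| <= C * expR (- d) ^+ n.
  move=> tn; rewrite (le_trans (fC t))// ler_wpM2l// tn -expRM_natl ler_expR.
  rewrite mulrN lerN2 mulrC ler_wpM2l ?(ltW d0)// -natrX ler_nat.
  by rewrite (leq_trans (leqnSn n))// -[leqLHS]muln1 leq_mul.
have cv0 : (f n.+1%:R - f (- n.+1%:R)) @[n --> \oo] --> 0.
  apply/cvgr0Pnorm_le => e e0.
  have h : (2 * C * expR (- d) ^+ n) @[n --> \oo] --> 2 * C * 0.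
    apply: cvgM; first exact: cvg_cst.
    apply: cvg_expr; rewrite ger0_norm ?expR_ge0//.
    by rewrite -expR0 ltr_expR oppr_lt0.
  move: h; rewrite mulr0 => /cvgr0_norm_le /(_ _ e0) [N _ HN].
  exists N => // n /= Nn; apply: le_trans (HN _ Nn).
  rewrite [leRHS]ger0_norm ?mulr_ge0 ?exprn_ge0 ?expR_ge0//.
  rewrite (le_trans (ler_normB _ _))// -[2]/(1 + 1) !mulrDl !mul1r.
  by rewrite lerD// f0// sqrrN.
rewrite /Rintegral.
have -> : (\int[mu]_x (df x)%:E = 0%:E)%E; last by [].
rewrite -(cvg_lim (@ereal_hausdorff R) H); apply/cvg_lim.
  exact: ereal_hausdorff.
under eq_fun do rewrite /= FE.
by apply/cvg_EFin; [exact: nearW|exact: cv0].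
Qed.
End RealLine.

Section CIntegral.
Variables (R : realType) (d : measure_display) (T : measurableType d).
Variable mu : {measure set T -> \bar R}.
Implicit Types (f g : T -> R[i]) (a : R[i]).

Definition cintegrable f :=
  mu.-integrable setT (fun x => (Re (f x))%:E) /\
  mu.-integrable setT (fun x => (Im (f x))%:E).

Lemma cintegrableD f g : cintegrable f -> cintegrable g ->
  cintegrable (fun x => f x + g x).
Proof.
move=> [f1 f2] [g1 g2]; split.
  by under eq_fun do rewrite cReD EFinD; exact: integrableD.
by under eq_fun do rewrite cImD EFinD; exact: integrableD.
Qed.

Lemma cintegralD f g : cintegrable f -> cintegrable g ->
  cintegral mu (fun x => f x + g x) = cintegral mu f + cintegral mu g.
Proof.
move=> [f1 f2] [g1 g2]; rewrite /cintegral.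
under eq_Rintegral do rewrite cReD; rewrite RintegralD//.
by under [X in _ +i* X]eq_Rintegral do rewrite cImD; rewrite RintegralD.
Qed.

Lemma cintegrableZ a f : cintegrable f -> cintegrable (fun x => a * f x).
Proof.
move=> [f1 f2]; split.
  under eq_fun do rewrite cReM EFinB !EFinM.
  by apply: integrableB => //; exact: integrableZl.
under eq_fun do rewrite cImM EFinD !EFinM.
by apply: integrableD => //; exact: integrableZl.
Qed.

Lemma cintegralZ a f : cintegrable f ->
  cintegral mu (fun x => a * f x) = a * cintegral mu f.
Proof.
move=> [f1 f2]; rewrite /cintegral.
have i1 (c : R) : mu.-integrable setT (fun x => (c * Re (f x))%:E).
  by under eq_fun do rewrite EFinM; exact: integrableZl.
have i2 (c : R) : mu.-integrable setT (fun x => (c * Im (f x))%:E).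
  by under eq_fun do rewrite EFinM; exact: integrableZl.
have e1 (c : R) : \int[mu]_x (c * Re (f x)) = c * \int[mu]_x Re (f x).
  exact: RintegralZl.
have e2 (c : R) : \int[mu]_x (c * Im (f x)) = c * \int[mu]_x Im (f x).
  exact: RintegralZl.
under eq_Rintegral do rewrite cReM.
rewrite (RintegralB measurableT (i1 _) (i2 _)) e1 e2.
under [X in _ +i* X]eq_Rintegral do rewrite cImM.
rewrite (RintegralD measurableT (i2 _) (i1 _)) e1 e2.
by case: a.
Qed.

Lemma cintegrable_dominated f (h : T -> R) :
  measurable_fun setT (fun x => Re (f x)) -> measurable_fun setT (fun x => Im (f x)) ->
  mu.-integrable setT (EFin \o h) -> (forall x, normc (f x) <= h x) ->
  cintegrable f.
Proof.
move=> m1 m2 ih fh; split; apply: le_integrable ih => //.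
- exact/measurable_EFinP.
- move=> x _ /=; rewrite lee_fin (le_trans (Re_le_normc _))//.
  by rewrite (le_trans (fh x))// ler_norm.
- exact/measurable_EFinP.
- move=> x _ /=; rewrite lee_fin (le_trans (Im_le_normc _))//.
  by rewrite (le_trans (fh x))// ler_norm.
Qed.

End CIntegral.

Section GaussDominated.
Variable R : realType.
Implicit Types (f g : R -> R[i]) (a : R[i]).
Local Notation mu := (@lebesgue_measure R).

Definition ccontinuous f :=
  continuous (fun x => Re (f x)) /\ continuous (fun x => Im (f x)).

(** The rate [d] depends on [f]: any positive one suffices for integrability. *)
Definition gauss_dominated f :=
  exists C d : R, 0 < d /\ forall x, normc (f x) <= C * expR (- (d * x ^+ 2)).

(** The functions to which integration by parts applies; they form a complex
    vector space. *)
Record tame f : Prop := Tame {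
  tame_continuous : ccontinuous f ; tame_dominated : gauss_dominated f }.

Lemma is_cderive_continuous f (df : R -> R[i]) :
  (forall x, is_cderive f x (df x)) -> ccontinuous f.
Proof.
move=> fdf; split=> x; apply: differentiable_continuous; apply/derivable1_diffP.
  exact: (@ex_derive _ _ _ _ _ _ _ (fdf x).1).
exact: (@ex_derive _ _ _ _ _ _ _ (fdf x).2).
Qed.

Lemma tameD f g : tame f -> tame g -> tame (fun x => f x + g x).
Proof.
move=> [[f1 f2] [C [d [d0 fC]]]] [[g1 g2] [D [e [e0 gD]]]]; split.
  split=> x.
    by under eq_fun do rewrite cReD; apply: cvgD; [exact: f1|exact: g1].
  by under eq_fun do rewrite cImD; apply: cvgD; [exact: f2|exact: g2].
exists (C + D), (Num.min d e); split; first by rewrite lt_min d0.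
move=> x; rewrite (le_trans (le_normcD _ _))// mulrDl.
have C0 : 0 <= C.
  by have := le_trans (normc_ge0 _) (fC x); rewrite pmulr_lge0 ?expR_gt0.
have D0 : 0 <= D.
  by have := le_trans (normc_ge0 _) (gD x); rewrite pmulr_lge0 ?expR_gt0.
apply: lerD.
  by rewrite (le_trans (fC x))// ler_wpM2l// ler_expR lerN2 ler_wpM2r ?sqr_ge0//
      ge_min lexx.
by rewrite (le_trans (gD x))// ler_wpM2l// ler_expR lerN2 ler_wpM2r ?sqr_ge0//
    ge_min lexx orbT.
Qed.

Lemma tameZ a f : tame f -> tame (fun x => a * f x).
Proof.
move=> [[f1 f2] [C [d [d0 fC]]]]; split.
  split=> x.
    under eq_fun do rewrite cReM; apply: cvgB; apply: cvgM; try exact: cvg_cst.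
      exact: f1.
    exact: f2.
  under eq_fun do rewrite cImM; apply: cvgD; apply: cvgM; try exact: cvg_cst.
    exact: f2.
  exact: f1.
exists (normc a * C), d; split => // x.
by rewrite normcM -mulrA ler_wpM2l ?normc_ge0.
Qed.

Lemma tame_integrable f : tame f -> cintegrable mu f.
Proof.
move=> [[f1 f2] [C [d [d0 fC]]]].
apply: (@cintegrable_dominated _ _ _ mu f (fun x => C * expR (- (d * x ^+ 2)))) => //.
- exact: continuous_measurable_fun.
- exact: continuous_measurable_fun.
- have := integrableZl measurableT C (integrable_gauss d0).
  by apply: eq_integrable.
Qed.

Lemma cintegral_derive_eq0 f df :
  (forall x, is_cderive f x (df x)) -> tame f -> tame df ->
  cintegral mu df = 0.
Proof.
move=> fdf [_ [C [d [d0 fC]]]] ndf.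
have [i1 i2] := tame_integrable ndf.
case: ndf => [[c1 c2] _].
have e1 : \int[mu]_x Re (df x) = 0.
  apply: (@integral_derive_eq0 _ (fun x => Re (f x)) _ C d) => // x.
    exact: (fdf x).1.
  by rewrite (le_trans (Re_le_normc _)).
have e2 : \int[mu]_x Im (df x) = 0.
  apply: (@integral_derive_eq0 _ (fun x => Im (f x)) _ C d) => // x.
    exact: (fdf x).2.
  by rewrite (le_trans (Im_le_normc _)).
by rewrite /cintegral e1 e2.
Qed.

End GaussDominated.

(** * Wigner functions of the matrix units *)

Section Ladder.
Variable R : realType.

(** A doubly indexed family is determined by its raising relations and its
    corner.  It identifies both the Wigner functions of the matrix units and
    their Fourier transforms. *)
Lemma ladder_unique (J : nat -> nat -> R[i]) (al : R[i]) :
  (forall m n, sqn R n.+1 * J m n.+1 = 2 * al * J m n - sqn R m * J m.-1 n) ->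
  (forall m, sqn R m.+1 * J m.+1 0 = 2 * conjc al * J m 0) ->
  forall m n, J m n = ito m n al * J 0 0.
Proof.
move=> Jr Jl m n; elim: n m => [|n IH] m.
  elim: m => [|m IH]; first by rewrite ito00 mul1r.
  by apply: (mulfI (sqn_neq0 R m)); rewrite Jl IH [RHS]mulrA ito_up0 mulrA.
apply: (mulfI (sqn_neq0 R n)); rewrite Jr !IH [RHS]mulrA ito_upr; ring.
Qed.

Lemma normc_cis (t : R) : normc (cis t) = 1.
Proof. by rewrite /cis /= cos2Dsin2 sqrtr1. Qed.

Lemma is_cderive_cis_comp (f : R -> R) (x l : R) : is_derive x 1 f l ->
  is_cderive (fun y => cis (f y)) x ('i%C * l%:C * cis (f x)).
Proof.
move=> df; split => /=.
  apply: (is_derive_eq (@is_derive1_comp R cos f x _ _ (is_derive_cos (f x)) df)).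
  by rewrite /=; ring.
apply: (is_derive_eq (@is_derive1_comp R sin f x _ _ (is_derive_sin (f x)) df)).
by rewrite /=; ring.
Qed.

Lemma is_cderive_cis (c x : R) :
  is_cderive (fun y => cis (c * y)) x ('i%C * c%:C * cis (c * x)).
Proof.
apply: is_cderive_cis_comp.
by apply: is_derive_eq; rewrite /GRing.scale/= mulr1.
Qed.

Local Notation mu := (@lebesgue_measure R).

Definition wigner_integrand m n (q p x : R) : R[i] :=
  cis (2 * p * x) * (fock m (q - x) * fock n (q + x))%:C.

(** The coordinate in which the annihilation operator has the symbol [al]. *)
Definition phase_point (q p : R) : R[i] := ((Num.sqrt 2)^-1)%:C * (q +i* p).

Lemma wigner_integrand_gauss_dominated m n (q p : R) :
  gauss_dominated (wigner_integrand m n q p).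
Proof.
have d4 : 0 < (4^-1 : R) < 2^-1 by lra.
have [C C0 HC] := fock_gauss_bound m d4.
have [D D0 HD] := fock_gauss_bound n d4.
exists (C * D), (2^-1); split => [|x]; first by rewrite invr_gt0.
rewrite normcM normc_cis mul1r normcR normrM.
apply: le_trans (ler_pM _ _ (HC _) (HD _)) _ => //.
rewrite mulrACA ler_wpM2l ?mulr_ge0// -expRD ler_expR.
by have := sqr_ge0 q; lra.
Qed.

(** The derivative of the integrand in [x], written with the ladder relations.
    In this form, its vanishing integral is the raising relation for the
    Wigner functions. *)
Definition wigner_integrand_dx m n (q p x : R) : R[i] :=
  (Num.sqrt 2)%:C * (2 * phase_point q p * wigner_integrand m n q p x
    - sqn R m * wigner_integrand m.-1 n q p x
    - sqn R n.+1 * wigner_integrand m n.+1 q p x).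

(** The factor [cis (2 p x)] produces the imaginary part of the phase point, and
    the identity [(q + x) - (q - x) = 2 x] together with [fock_up] its real part. *)
Lemma is_cderive_wigner_integrand m n (q p x : R) :
  is_cderive (wigner_integrand m n q p) x (wigner_integrand_dx m n q p x).
Proof.
have d1 : is_derive x 1 (fun y => fock m (q - y)) (- (Num.sqrt 2 * Num.sqrt m%:R *
    fock m.-1 (q - x) - (q - x) * fock m (q - x))).
  have h : is_derive x 1 (fun y : R => q - y) (- 1).
    by apply: is_derive_eq; ring.
  have := @is_derive1_comp R (fock m) (fun y => q - y) x _ _ (is_derive_fock m (q -
      x)) h; rewrite mulrN1.
  exact.
have d2 : is_derive x 1 (fun y => fock n (q + y)) (Num.sqrt 2 * Num.sqrt n%:R *
    fock n.-1 (q + x) - (q + x) * fock n (q + x)).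
  have h : is_derive x 1 (fun y : R => q + y) 1.
    by apply: is_derive_eq; ring.
  have := @is_derive1_comp R (fock n) (fun y => q + y) x _ _ (is_derive_fock n (q +
      x)) h; rewrite mulr1.
  exact.
apply: (is_cderive_eq (is_cderiveM (is_cderive_cis (2 * p) x)
  (is_cderive_real (is_deriveM d1 d2)))).
rewrite /wigner_integrand_dx /wigner_integrand /phase_point.
have -> : sqn R n.+1 * (cis (2 * p * x) * (fock m (q - x) * fock n.+1 (q + x))%:C)
  = cis (2 * p * x) * (fock m (q - x) * (Num.sqrt n.+1%:R * fock n.+1 (q + x)))%:C.
  by rewrite /sqn !rmorphM/=; ring.
rewrite fock_up /sqn [((_ * _) x)]/(fock m (q - x) * fock n (q + x)).
have S := @sqr_sqrt2 R; have s0 := lt0r_neq0 (@sqrt2_gt0 R).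
move: (Num.sqrt 2) S s0 (cis _) (fock m (q - x)) (fock m.-1 (q - x))
  (fock n (q + x)) (fock n.-1 (q + x)) (Num.sqrt m%:R) (Num.sqrt n%:R) => r S r0.
move=> [c s] f f1 h h1 sm sn; rewrite /GRing.scale/=.
have -> : (q +i* p) = q%:C + 'i%C * p%:C by apply/eqP; rewrite eq_complex/=
    !(mul0r, mul1r, addr0, add0r, subr0, mulr0) !eqxx.
have -> : (r * (q + x) * h - sn * h1) = r * ((q + x) * h) - sn * h1 by ring.
have E : r%:C * (r^-1)%:C = 1 by rewrite -rmorphM/= mulfV.
transitivity (2 * (r%:C * (r^-1)%:C) * (q%:C + 'i%C * p%:C) * ((c +i* s) * (f * h)%:C)
  - r%:C * sm%:C * ((c +i* s) * (f1 * h)%:C)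
  - (c +i* s) * (f * ((r * r) * ((q + x) * h) - r * sn * h1))%:C); last first.
  by rewrite [X in _ - X](_ : _ = r%:C * ((c +i* s) * (f * (r * ((q + x) * h) - sn
      * h1))%:C)); [ring|rewrite !rmorphM/= !rmorphB/= !rmorphM/=; ring].
rewrite E S mulr1.
move: (c +i* s) => z; rewrite !(rmorphM, rmorphB, rmorphD, rmorphN, rmorph_nat)/=; ring.
Qed.

Lemma tame_wigner_integrand m n q p : tame (wigner_integrand m n q p).
Proof.
split; last exact: wigner_integrand_gauss_dominated.
exact: is_cderive_continuous (is_cderive_wigner_integrand m n q p).
Qed.

Lemma phase_pointE q p : 2 * phase_point q p = (Num.sqrt 2)%:C * (q +i* p).
Proof.
have s0 := lt0r_neq0 (@sqrt2_gt0 R).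
have E : (Num.sqrt 2)%:C * ((Num.sqrt 2)^-1)%:C = 1 :> R[i].
  by rewrite -rmorphM/= mulfV.
have E2 : 2 = (Num.sqrt 2)%:C * (Num.sqrt 2)%:C :> R[i].
  by rewrite -rmorphM/= sqr_sqrt2 -[RHS]/(real_complex R 2%:R) rmorph_nat.
by rewrite /phase_point E2 -[LHS]mulrA [X in _ * X]mulrA E mul1r.
Qed.

(** Adding the two raising relations gives multiplication by [q], as
    [(q - x) + (q + x) = 2 q], and their difference is the derivative in [x]. *)
Lemma wigner_integrand_upl m n q p x :
  sqn R m.+1 * wigner_integrand m.+1 n q p x =
  2 * conjc (phase_point q p) * wigner_integrand m n q p x
  - sqn R n * wigner_integrand m n.-1 q p x
  + ((Num.sqrt 2)^-1)%:C * wigner_integrand_dx m n q p x.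
Proof.
rewrite /wigner_integrand_dx [((Num.sqrt 2)^-1)%:C * _]mulrA -rmorphM/= mulVf
    ?lt0r_neq0 ?sqrt2_gt0// mul1r.
have -> : 2 * conjc (phase_point q p) = conjc (2 * phase_point q p).
  by ring.
have : 2 * phase_point q p = (Num.sqrt 2)%:C * (2 * q)%:C - conjc (2 * phase_point q p).
  rewrite phase_pointE; apply/eqP; rewrite eq_complex/=; apply/andP; split;
      apply/eqP; ring.
move: (conjc (2 * _)) => z ->.
rewrite /wigner_integrand; set e := cis _.
have U1 := fock_up m (q - x); have U2 := fock_up n (q + x).
rewrite [LHS](_ : _ = e * ((Num.sqrt m.+1%:R * fock m.+1 (q - x)) * fock n (q + x))%:C).
  rewrite [X in _ = _ + (_ - X)](_ : _ = e * (fock m (q - x) * (Num.sqrt n.+1%:R *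
      fock n.+1 (q + x)))%:C).
    rewrite U1 U2 /sqn.
    move: e (fock m _) (fock m.-1 _) (fock n _) (fock n.-1 _) (Num.sqrt m%:R)
        (Num.sqrt n%:R) (Num.sqrt 2).
    move=> e f f1 h h1 sm sn r.
    rewrite !(rmorphM, rmorphB, rmorphD, rmorphN, rmorph_nat)/=; ring.
  by rewrite /sqn !rmorphM/=; ring.
by rewrite /sqn !rmorphM/=; ring.
Qed.

Definition wigner_amplitude m n q p := cintegral mu (wigner_integrand m n q p).

Lemma tame_wigner_dx m n q p : tame (wigner_integrand_dx m n q p).
Proof.
rewrite /wigner_integrand_dx; apply: tameZ.
have N i j a : tame (fun x => - (a * wigner_integrand i j q p x)).
  by under eq_fun do rewrite -mulNr; apply: tameZ; exact: tame_wigner_integrand.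
apply: tameD (N _ _ _); apply: tameD (N _ _ _); apply: tameZ.
exact: tame_wigner_integrand.
Qed.

Lemma cintegral_wigner_dx m n q p : cintegral mu (wigner_integrand_dx m n q p) = 0.
Proof.
apply: cintegral_derive_eq0 (is_cderive_wigner_integrand m n q p) _ _.
  exact: tame_wigner_integrand.
exact: tame_wigner_dx.
Qed.

Lemma cintegral_relation (F G H D : R -> R[i]) (c a b e : R[i]) :
  tame F -> tame G -> tame H -> tame D -> cintegral mu D = 0 ->
  (forall x, c * F x = a * G x - b * H x + e * D x) ->
  c * cintegral mu F = a * cintegral mu G - b * cintegral mu H.
Proof.
move=> nF nG nH nD D0 E.
have iF := tame_integrable nF; have iG := tame_integrable nG.
have iH := tame_integrable nH; have iD := tame_integrable nD.
rewrite -(cintegralZ c iF).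
have -> : (fun x => c * F x) = (fun x => a * G x + (- b) * H x + e * D x).
  by apply/funext => x; rewrite E mulNr.
rewrite cintegralD; last 2 first.
- by apply: cintegrableD; exact: cintegrableZ.
- exact: cintegrableZ.
rewrite cintegralD; last 2 first.
- exact: cintegrableZ.
- exact: cintegrableZ.
by rewrite !cintegralZ// D0 mulr0 addr0 mulNr.
Qed.

(** The raising relations survive integration because the derivative in [x]
    integrates to 0. *)
Lemma wigner_amplitude_upl m n q p :
  sqn R m.+1 * wigner_amplitude m.+1 n q p =
  2 * conjc (phase_point q p) * wigner_amplitude m n q p -
  sqn R n * wigner_amplitude m n.-1 q p.
Proof.
apply: (cintegral_relation _ _ _ (tame_wigner_dx m n q p)
  (cintegral_wigner_dx m n q p) (wigner_integrand_upl m n q p));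
  exact: tame_wigner_integrand.
Qed.

Lemma wigner_amplitude_upr m n q p :
  sqn R n.+1 * wigner_amplitude m n.+1 q p =
  2 * phase_point q p * wigner_amplitude m n q p -
  sqn R m * wigner_amplitude m.-1 n q p.
Proof.
apply: (@cintegral_relation _ _ _ _ _ _ _ (- ((Num.sqrt 2)^-1)%:C) _ _ _
  (tame_wigner_dx m n q p) (cintegral_wigner_dx m n q p));
  try exact: tame_wigner_integrand.
move=> x; rewrite /wigner_integrand_dx mulNr [((Num.sqrt 2)^-1)%:C * _]mulrA -rmorphM/=.
by rewrite mulVf ?lt0r_neq0 ?sqrt2_gt0// mul1r; ring.
Qed.

Lemma wigner_amplitude_ito m n q p : wigner_amplitude m n q p =
  ito m n (phase_point q p) * wigner_amplitude 0 0 q p.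
Proof.
apply: (@ladder_unique (fun i j => wigner_amplitude i j q p)) => [i j|i].
  exact: wigner_amplitude_upr.
by rewrite wigner_amplitude_upl sqn0 mul0r subr0.
Qed.

End Ladder.

Section GaussFourier.
Variable R : realType.
Local Notation mu := (@lebesgue_measure R).

Lemma is_cderive_integral (f df : R -> R -> R[i]) (h : R -> R) (p : R) :
  (forall t, cintegrable mu (f t)) ->
  (forall t x, is_cderive (f ^~ x) t (df t x)) ->
  mu.-integrable setT (EFin \o h) ->
  (forall t x, normc (df t x) <= h x) ->
  is_cderive (fun t => cintegral mu (f t)) p (cintegral mu (df p)).
Proof.
move=> intf fdf ih dfh.
have h0 x : 0 <= h x by rewrite (le_trans _ (dfh p x))// normc_ge0.
have key (g dg : R -> R -> R) :
    (forall t, mu.-integrable setT (EFin \o g t)) ->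
    (forall t x : R, is_derive t 1 (g ^~ x) (dg t x)) ->
    (forall t x, `|dg t x| <= h x) ->
    is_derive p 1 (fun t => \int[mu]_x g t x) (\int[mu]_x dg p x).
  move=> ig gdg dgh.
  have dE t x : partial1of2 g t x = dg t x.
    by rewrite /partial1of2 (derive1_is_derive (gdg ^~ x)).
  have pI : [set` `]p - 1, p + 1[%R] p.
    by rewrite /= in_itv/= ltrBlDr ltrDl ltr01.
  have H1 := @derivable_under_integral R _ _ mu g setT measurableT p (p - 1)
    (p + 1) pI (fun t _ => ig t)
    (fun t x _ _ => @ex_derive _ _ _ _ _ _ _ (gdg t x)) h h0 ih
    (fun t x _ _ => eq_ind_r (fun u => `|u| <= h x) (dgh t x) (dE t x)).
  have H2 := @differentiation_under_integral R _ _ mu g setT measurableT p (p - 1)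
    (p + 1) pI (fun t _ => ig t)
    (fun t x _ _ => @ex_derive _ _ _ _ _ _ _ (gdg t x)) h h0 ih
    (fun t x _ _ => eq_ind_r (fun u => `|u| <= h x) (dgh t x) (dE t x)).
  apply: DeriveDef => //; rewrite -derive1E H2.
  by apply: eq_Rintegral => x _; exact: dE.
split.
  apply: (key (fun t x => Re (f t x)) (fun t x => Re (df t x))) => [t|t x|t x].
  - exact: (intf t).1.
  - exact: (fdf t x).1.
  - by rewrite (le_trans (Re_le_normc _)).
apply: (key (fun t x => Im (f t x)) (fun t x => Im (df t x))) => [t|t x|t x].
- exact: (intf t).2.
- exact: (fdf t x).2.
- by rewrite (le_trans (Im_le_normc _)).
Qed.

Lemma is_cderive0_cst (f : R -> R[i]) : (forall x, is_cderive f x 0) ->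
  forall x y, f x = f y.
Proof.
move=> f0 x y; apply/eqP; rewrite eq_complex; apply/andP; split; apply/eqP.
  by apply: (@is_derive_0_is_cst R (fun t => Re (f t))) => t; exact: (f0 t).1.
by apply: (@is_derive_0_is_cst R (fun t => Im (f t))) => t; exact: (f0 t).2.
Qed.

Definition gauss_wave (p x : R) : R[i] := cis (2 * p * x) * (expR (- x ^+ 2))%:C.

Lemma gauss_wave_bound p x : normc (gauss_wave p x) <= 1 * expR (- (1 * x ^+ 2)).
Proof. by rewrite normcM normc_cis mul1r normcR ger0_norm ?expR_ge0// !mul1r. Qed.

Lemma is_cderive_expN (x : R) : is_cderive (fun t => (expR (- t ^+ 2))%:C) x
  (- (2 * x) * expR (- x ^+ 2))%:C.
Proof.
have h := is_derive_gauss (-1) x; apply: is_cderive_real.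
under eq_fun do rewrite -mulN1r.
by apply: (is_derive_eq h); rewrite mulN1r; ring.
Qed.

Lemma is_cderive_gauss_wave p x : is_cderive (gauss_wave p) x
  ('i%C * (2 * p)%:C * gauss_wave p x + (- (2 * x))%:C * gauss_wave p x).
Proof.
apply: (is_cderive_eq (is_cderiveM (is_cderive_cis (2 * p) x) (is_cderive_expN x))).
by rewrite /gauss_wave !rmorphM/=; ring.
Qed.

Lemma tame_gauss_wave p : tame (gauss_wave p).
Proof.
split; first exact: is_cderive_continuous (is_cderive_gauss_wave p).
by exists 1, 1; split => // x; exact: gauss_wave_bound.
Qed.

Lemma moment_gauss_wave_bound p x :
  normc ((2 * x)%:C * gauss_wave p x) <= 4 * expR (- (2^-1 * x ^+ 2)).
Proof.
rewrite normcM normcR normrM ger0_norm//.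
have xb : `|x| <= (2^-1)^-1 * expR (2^-1 * x ^+ 2).
  by apply: normr_le_gauss; lra.
apply: (@le_trans _ _ (2 * ((2^-1)^-1 * expR (2^-1 * x ^+ 2)) * (1 * expR (- (1 * x
    ^+ 2))))).
  by rewrite ler_pM ?mulr_ge0 ?normc_ge0 ?gauss_wave_bound// ler_wpM2l.
rewrite invrK (_ : - (2^-1 * x ^+ 2) = 2^-1 * x ^+ 2 + - (1 * x ^+ 2)); last by field.
by rewrite expRD mul1r; lra.
Qed.

Lemma tame_moment_gauss_wave p : tame (fun x => (2 * x)%:C * gauss_wave p x).
Proof.
have h x : is_cderive (fun t : R => (2 * t)%:C) x 2%:C.
  by apply: is_cderive_real; apply: is_derive_eq; rewrite /GRing.scale/= mulr1.
split.
  exact: is_cderive_continuous (fun x => is_cderiveM (h x) (is_cderive_gauss_wave p x)).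
by exists 4, (2^-1); split; [rewrite invr_gt0|exact: moment_gauss_wave_bound].
Qed.

Definition gauss_hat p := cintegral mu (gauss_wave p).

(** The Fourier transform of a Gaussian satisfies the differential equation of a
    Gaussian: differentiation in [p] multiplies the integrand by [2 i x], and
    integration by parts trades [x] for [p].  The value at 0 remains as a constant. *)
Lemma is_cderive_gauss_hat p :
  is_cderive gauss_hat p ((- (2 * p))%:C * gauss_hat p).
Proof.
have dp t x : is_cderive (gauss_wave ^~ x) t ('i%C * ((2 * x)%:C * gauss_wave t x)).
  rewrite /gauss_wave.
  have -> : (fun t : R => cis (2 * t * x) * (expR (- x ^+ 2))%:C) =
      (fun t : R => (expR (- x ^+ 2))%:C * cis ((2 * x) * t)).
    by apply/funext => u; rewrite mulrC; congr (_ * cis _); ring.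
  apply: (is_cderive_eq (is_cderiveZ _ (is_cderive_cis (2 * x) t))).
  by rewrite (_ : 2 * x * t = 2 * t * x); ring.
have b0 t x : normc ('i%C * ((2 * x)%:C * gauss_wave t x)) <= 4 * expR (- (2^-1 * x
    ^+ 2)).
  rewrite normcM (_ : normc 'i%C = 1) ?mul1r; first exact: moment_gauss_wave_bound.
  by rewrite /= expr0n add0r expr1n sqrtr1.
have ih : mu.-integrable setT (EFin \o (fun x => 4 * expR (- (2^-1 * x ^+ 2)))).
  have h0 : 0 < (2^-1 : R) by rewrite invr_gt0.
  have := integrableZl measurableT 4 (integrable_gauss h0).
  by apply: eq_integrable.
apply: (is_cderive_eq (is_cderive_integral p
  (fun t => tame_integrable (tame_gauss_wave t)) dp ih b0)).
have nD : tame (fun x => 'i%C * (2 * p)%:C * gauss_wave p x + (- (2 * x))%:C *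
    gauss_wave p x).
  apply: tameD; first exact: tameZ (tame_gauss_wave p).
  have := tameZ (-1) (tame_moment_gauss_wave p).
  by under eq_fun do rewrite mulrA mulN1r -rmorphN.
have D0 := cintegral_derive_eq0 (is_cderive_gauss_wave p) (tame_gauss_wave p) nD.
have n0 : tame (fun=> 0 : R[i]).
  by have := tameZ 0 (tame_gauss_wave p); under eq_fun do rewrite mul0r.
have nM := tameZ 'i%C (tame_moment_gauss_wave p).
have := cintegral_relation (c := 1) (a := (- (2 * p))%:C) (b := 0) (e := - 'i%C)
  nM (tame_gauss_wave p) n0 nD D0.
rewrite !mul0r !subr0 !mul1r; apply => x.
rewrite mul1r subr0 [(- (2 * p))%:C]rmorphN [(- (2 * x))%:C]rmorphN/= mulrDr.
have i2 : 'i%C * 'i%C = -1 :> R[i] by rewrite -expr2 sqr_i.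
transitivity ('i%C * ((2 * x)%:C * gauss_wave p x) + (1 + 'i%C * 'i%C) * - ((2 *
    p)%:C * gauss_wave p x)); [by rewrite i2 subrr mul0r addr0|ring].
Qed.

Lemma gauss_hatE p : gauss_hat p = (expR (- p ^+ 2))%:C * gauss_hat 0.
Proof.
have dE t : is_cderive (fun u => (expR (1 * u ^+ 2))%:C * gauss_hat u) t 0.
  apply: (is_cderive_eq (is_cderiveM (is_cderive_real (is_derive_gauss 1 t))
    (is_cderive_gauss_hat t))).
  by rewrite !rmorphM rmorphN/=; ring.
have := is_cderive0_cst dE p 0.
rewrite expr0n mulr0 expR0 rmorph1 [1 * gauss_hat 0]mul1r => <-.
by rewrite mulrA -rmorphM/= -expRD mul1r addNr expR0 mul1r.
Qed.

End GaussFourier.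

Section WignerBasis.
Variable R : realType.

Lemma normc_phase_point (q p : R) : normc (phase_point q p) ^+ 2 = (q ^+ 2 + p ^+
    2) / 2.
Proof.
rewrite /phase_point normcM normcR exprMn sqr_normcE/= real_normK ?num_real//.
by rewrite exprVn sqr_sqrtr// mulrC.
Qed.

(** [ito_gaussian_bound] at [r = t ^+ 2], after taking square roots; the Gaussian
    factor on the left is that of the Wigner functions and turns the growth of
    the polynomials into decay. *)
Lemma ito_gauss_decay (t : R) (al : R[i]) m n : 0 < t < 1 ->
  normc (ito m n al) * expR (- (2 * normc al ^+ 2)) <=
  (1 - t ^+ 2)^-1 * (t^-1) ^+ (m + n) *
  expR (- ((1 - t ^+ 2) / (1 + t ^+ 2) * (2 * normc al ^+ 2))).
Proof.
move=> /andP[t0 t1].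
have t2 : 0 < t ^+ 2 < 1.
  by rewrite exprn_gt0//= -(expr1n _ 2) ltr_pXn2r ?nnegrE ?(ltW t0).
have /andP[t20 t21] := t2.
have u0 : 0 < 1 - t ^+ 2 by rewrite subr_gt0.
have := ito_gaussian_bound al m n t2.
set A := normc al ^+ 2; set x := normc (ito m n al) => H.
rewrite -(@ler_pXn2r _ 2) ?nnegrE ?mulr_ge0 ?expR_ge0 ?normc_ge0 ?exprn_ge0
    ?invr_ge0 ?(ltW u0) ?(ltW t0)//.
set k := (m + n)%N; rewrite [leRHS]exprMn exprMn.
have -> : expR (- ((1 - t ^+ 2) / (1 + t ^+ 2) * (2 * A))) ^+ 2 =
    expR (- (2 * A)) ^+ 2 * expR (8 * t ^+ 2 / (1 + t ^+ 2) * A).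
  rewrite -!expRM_natl -expRD; congr expR; field.
  by rewrite gt_eqF// addr_gt0.
have -> : ((1 - t ^+ 2)^-1 * t^-1 ^+ k) ^+ 2 = (1 - t ^+ 2) ^- 2 / (t ^+ 2) ^+ k.
  by rewrite exprMn !exprVn -!exprM mulnC.
set E1 := expR (- (2 * A)) ^+ 2; set X := expR (8 * _ / _ * A).
rewrite [leRHS](_ : _ = (1 - t ^+ 2) ^- 2 * X / (t ^+ 2) ^+ k * E1); last by ring.
rewrite ler_wpM2r ?exprn_ge0 ?expR_ge0// ler_pdivlMr ?exprn_gt0// mulrC.
exact: H.
Qed.

Lemma wigner_amplitude00 (q p : R) : wigner_amplitude 0 0 q p =
  ((fock_norm R 0) ^+ 2 * expR (- (q ^+ 2 + p ^+ 2)))%:C * gauss_hat 0.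
Proof.
rewrite /wigner_amplitude.
have -> : wigner_integrand 0 0 q p =
   (fun x => ((fock_norm R 0) ^+ 2 * expR (- q ^+ 2))%:C * gauss_wave p x).
  apply/funext => x; rewrite /wigner_integrand /gauss_wave !fockE !hermite0 !mul1r.
  rewrite [RHS]mulrCA -[in RHS]rmorphM/=; congr (_ * _%:C).
  rewrite mulrACA -expRD -expr2 -[RHS]mulrA -expRD.
  by congr (_ * expR _); field.
transitivity (((fock_norm R 0) ^+ 2 * expR (- q ^+ 2))%:C * gauss_hat p).
  exact: (cintegralZ _ (tame_integrable (tame_gauss_wave p))).
rewrite gauss_hatE mulrA -rmorphM/=; congr (_%:C * _).
by rewrite opprD expRD mulrA.
Qed.

(** The value at the origin of the Wigner function of the vacuum. *)
Definition wigner_vacuum : R[i] := (pi^-1 * (fock_norm R 0) ^+ 2)%:C * gauss_hat 0.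

Lemma wigner_basisE m n (q p : R) : wigner_basis m n q p =
  wigner_vacuum * (ito m n (phase_point q p) * (expR (- (q ^+ 2 + p ^+ 2)))%:C).
Proof.
rewrite /wigner_basis -[cintegral _ _]/(wigner_amplitude m n q p).
rewrite wigner_amplitude_ito wigner_amplitude00 /wigner_vacuum !rmorphM/=; ring.
Qed.

Lemma wigner_basis_decay (t : R) m n (q p : R) : 0 < t < 1 ->
  normc (wigner_basis m n q p) <= normc wigner_vacuum * (1 - t ^+ 2)^-1 *
    (t^-1) ^+ (m + n) * expR (- ((1 - t ^+ 2) / (1 + t ^+ 2) * (q ^+ 2 + p ^+ 2))).
Proof.
move=> t01; rewrite wigner_basisE 2!normcM normcR ger0_norm ?expR_ge0//.
have -> : q ^+ 2 + p ^+ 2 = 2 * normc (phase_point q p) ^+ 2.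
  by rewrite normc_phase_point mulrC divfK.
apply: le_trans (ler_wpM2l (normc_ge0 _) (ito_gauss_decay _ _ _ t01)) _.
by rewrite !mulrA.
Qed.

End WignerBasis.

(** * Integration over the phase plane *)

Section CFubini.
Context d1 d2 (T1 : measurableType d1) (T2 : measurableType d2) (R : realType).
Variable m1 : {sigma_finite_measure set T1 -> \bar R}.
Variable m2 : {sigma_finite_measure set T2 -> \bar R}.
Variable f : T1 * T2 -> R[i].
Hypothesis If : cintegrable (m1 \x m2)%E f.

Lemma cintegral_prod12 : (forall x, cintegrable m2 (fun y => f (x, y))) ->
  cintegral (m1 \x m2)%E f = cintegral m1 (fun x => cintegral m2 (fun y => f (x, y))).
Proof.
move=> Ix; case: If => i1 i2; rewrite /cintegral /Rintegral.
congr (fine _ +i* fine _).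
  rewrite -(integral12_prod_meas1 i1); apply: eq_integral => x _ /=.
  by rewrite /fubini_F fineK//; exact: integrable_fin_num (Ix x).1.
rewrite -(integral12_prod_meas1 i2); apply: eq_integral => x _ /=.
by rewrite /fubini_F fineK//; exact: integrable_fin_num (Ix x).2.
Qed.

Lemma cintegral_prod21 : (forall y, cintegrable m1 (fun x => f (x, y))) ->
  cintegral (m1 \x m2)%E f = cintegral m2 (fun y => cintegral m1 (fun x => f (x, y))).
Proof.
move=> Iy; case: If => i1 i2; rewrite /cintegral /Rintegral.
congr (fine _ +i* fine _).
  rewrite -(integral21_prod_meas1 i1); apply: eq_integral => x _ /=.
  by rewrite /fubini_G fineK//; exact: integrable_fin_num (Iy x).1.
rewrite -(integral21_prod_meas1 i2); apply: eq_integral => x _ /=.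
by rewrite /fubini_G fineK//; exact: integrable_fin_num (Iy x).2.
Qed.

End CFubini.

Section CMeasurable.
Context (d : measure_display) (T : measurableType d) (R : realType).
Implicit Types f g : T -> R[i].

Definition cmeasurable f :=
  measurable_fun setT (fun x => Re (f x)) /\ measurable_fun setT (fun x => Im (f x)).

Lemma cmeasurable_cst (a : R[i]) : cmeasurable (fun=> a).
Proof. by split; exact: measurable_cst. Qed.

Lemma cmeasurableD f g : cmeasurable f -> cmeasurable g ->
  cmeasurable (fun x => f x + g x).
Proof.
move=> [f1 f2] [g1 g2]; split.
  by under eq_fun do rewrite cReD; exact: measurable_funD.
by under eq_fun do rewrite cImD; exact: measurable_funD.
Qed.

Lemma cmeasurableM f g : cmeasurable f -> cmeasurable g ->
  cmeasurable (fun x => f x * g x).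
Proof.
move=> [f1 f2] [g1 g2]; split.
  by under eq_fun do rewrite cReM; apply: measurable_funB; exact: measurable_funM.
by under eq_fun do rewrite cImM; apply: measurable_funD; exact: measurable_funM.
Qed.

Lemma cmeasurable_conj f : cmeasurable f -> cmeasurable (fun x => conjc (f x)).
Proof.
move=> [f1 f2]; split; first by under eq_fun do rewrite ReJ.
by under eq_fun do rewrite ImJ; exact: measurable_funN.
Qed.

Lemma cmeasurable_real (f : T -> R) : measurable_fun setT f ->
  cmeasurable (fun x => (f x)%:C).
Proof. by split => //; exact: measurable_cst. Qed.

Lemma cmeasurable_cis (f : T -> R) : measurable_fun setT f ->
  cmeasurable (fun x => cis (f x)).
Proof.
move=> mf; split => /=.
  apply: (measurableT_comp _ mf); apply: continuous_measurable_fun.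
  exact: continuous_cos.
apply: (measurableT_comp _ mf); apply: continuous_measurable_fun.
exact: continuous_sin.
Qed.

Lemma cmeasurable_ito f m n : cmeasurable f -> cmeasurable (fun x => ito m n (f x)).
Proof.
move=> mf; elim: n m => [|n IH] m.
  elim: m => [|m IH]; first exact: cmeasurable_cst.
  have -> : (fun x => ito m.+1 0 (f x)) =
      (fun x => (sqn R m.+1)^-1 * (2 * conjc (f x) * ito m 0 (f x))).
    by apply/funext => x; rewrite -ito_up0 mulKf ?sqn_neq0.
  apply: cmeasurableM; first exact: cmeasurable_cst.
  apply: cmeasurableM IH; apply: cmeasurableM; first exact: cmeasurable_cst.
  exact: cmeasurable_conj.
have -> : (fun x => ito m n.+1 (f x)) = (fun x => (sqn R n.+1)^-1 *
    (2 * f x * ito m n (f x) + - sqn R m * ito m.-1 n (f x))).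
  by apply/funext => x; rewrite mulNr -ito_upr mulKf ?sqn_neq0.
apply: cmeasurableM; first exact: cmeasurable_cst.
apply: cmeasurableD; apply: cmeasurableM (IH _).
  by apply: cmeasurableM mf; exact: cmeasurable_cst.
exact: cmeasurable_cst.
Qed.

End CMeasurable.

Section Plane.
Variable R : realType.
Local Notation mu := (@lebesgue_measure R).

Lemma integrable_gauss2 (K c : R) : 0 < c -> (mu \x mu)%E.-integrable setT
  (EFin \o (fun z : R * R => K * expR (- (c * (z.1 ^+ 2 + z.2 ^+ 2))))).
Proof.
move=> c0.
have h : (mu \x mu)%E.-integrable setT
    (EFin \o (fun z : R * R => expR (- (c * (z.1 ^+ 2 + z.2 ^+ 2))))).
  have mE : measurable_fun setT (fun z : R * R => expR (- (c * (z.1 ^+ 2 + z.2 ^+ 2)))).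
    apply: measurableT_comp => //; apply: measurable_funN.
    apply: measurable_funM => //; apply: measurable_funD;
      by apply: measurable_funX.
  apply/integrable12ltyP; first exact/measurable_EFinP.
  have ig := integrable_gauss c0.
  set e := fun x : R => expR (- (c * x ^+ 2)).
  have E1 x : (\int[mu]_y `|(EFin \o (fun z : R * R => expR (- (c * (z.1 ^+ 2 + z.2
      ^+ 2))))) (x, y)|
     = (e x)%:E * \int[mu]_y (e y)%:E)%E.
    rewrite -integralZl//; apply: eq_integral => y _ /=.
    by rewrite ger0_norm ?expR_ge0// -EFinM -expRD; congr (expR _)%:E; ring.
  under eq_integral do rewrite E1.
  have ife := integrable_fin_num measurableT ig.
  under eq_integral do rewrite -(fineK ife) muleC.
  rewrite integralZl//.
  by rewrite ltey_eq fin_numM.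
have := integrableZl measurableT K h.
by apply: eq_integrable.
Qed.

End Plane.

(** * Fourier transforms of the matrix-unit Wigner functions *)

Section PlaneFourier.
Variable R : realType.
Local Notation mu := (@lebesgue_measure R).
Local Notation mu2 := (mu \x mu)%E.

(** The derivative in the phase point of the family [w] of Wigner functions;
    [lower_l] is the one in its conjugate. *)
Definition lower_r (w : nat -> nat -> R[i]) m n : R[i] :=
  sqn R n * w m n.-1 - sqn R m.+1 * w m.+1 n.
Definition lower_l (w : nat -> nat -> R[i]) m n : R[i] :=
  sqn R m * w m.-1 n - sqn R n.+1 * w m n.+1.

(** The polarised form of the squared modulus; it gives the derivative of the
    Gaussian factor. *)
Lemma phase_point_polar (q p dq dp : R) :
  phase_point dq dp * conjc (phase_point q p) +
  conjc (phase_point dq dp) * phase_point q p = (q * dq + p * dp)%:C.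
Proof.
have E : ((Num.sqrt 2)^-1) * ((Num.sqrt 2)^-1) = 2^-1 :> R.
  by rewrite -invfM sqr_sqrt2.
apply/eqP; rewrite eq_complex /phase_point /= !(mul0r, subr0, addr0, oppr0, mulr0).
apply/andP; split; apply/eqP; last by ring.
set k := (Num.sqrt 2)^-1 in E *.
transitivity ((k * k) * 2 * (q * dq + p * dp)); first by ring.
by rewrite E; field.
Qed.

(** In the Appell rule for [ito], the derivative of the Gaussian contributes
    [- 2 conj al] and [- 2 al]; the raising relations absorb these, and what
    remains is linear in the neighbours with constant coefficients. *)
Lemma is_cderive_wigner_basis m n (fq fp : R -> R) (s dq dp : R) :
  is_derive s 1 fq dq -> is_derive s 1 fp dp ->
  is_cderive (fun t => wigner_basis m n (fq t) (fp t)) s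
    (phase_point dq dp * lower_r (fun i j => wigner_basis i j (fq s) (fp s)) m n +
     conjc (phase_point dq dp) *
       lower_l (fun i j => wigner_basis i j (fq s) (fp s)) m n).
Proof.
move=> hq hp.
have dal : is_cderive (fun t => phase_point (fq t) (fp t)) s (phase_point dq dp).
  by rewrite /phase_point; apply: is_cderiveZ; split.
have de : is_derive s 1 (fun t => expR (- (fq t ^+ 2 + fp t ^+ 2)))
    (- 2 * (fq s * dq + fp s * dp) * expR (- (fq s ^+ 2 + fp s ^+ 2))).
  have h : is_derive s 1 (fun t => - (fq t ^+ 2 + fp t ^+ 2)) (- (2 * (fq s * dq) +
      2 * (fp s * dp))).
    by apply: is_derive_eq; rewrite /GRing.scale/=; ring.
  apply: (is_derive_eq (@is_derive1_comp R expR _ s _ _ (is_derive_expR _) h)).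
  by ring.
have -> : (fun t => wigner_basis m n (fq t) (fp t)) = (fun t => wigner_vacuum R *
   (ito m n (phase_point (fq t) (fp t)) * (expR (- (fq t ^+ 2 + fp t ^+ 2)))%:C)).
  by apply/funext => t; rewrite wigner_basisE.
apply: (is_cderive_eq (is_cderiveZ (wigner_vacuum R)
  (is_cderiveM (is_cderive_ito m n dal) (is_cderive_real de)))).
rewrite /lower_l /lower_r !wigner_basisE.
set e := (expR _)%:C; set al := phase_point (fq s) (fp s); set a := phase_point dq dp.
have -> : (- 2 * (fq s * dq + fp s * dp) * expR (- (fq s ^+ 2 + fp s ^+ 2)))%:C =
    - 2 * (a * conjc al + conjc a * al) * e.
  by rewrite phase_point_polar !rmorphM rmorphN rmorph_nat.
set w0 := wigner_vacuum R.
have -> : sqn R m.+1 * (w0 * (ito m.+1 n al * e)) = w0 * ((sqn R m.+1 * ito m.+1 n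
    al) * e) by ring.
have -> : sqn R n.+1 * (w0 * (ito m n.+1 al * e)) = w0 * ((sqn R n.+1 * ito m n.+1
    al) * e) by ring.
rewrite ito_upl ito_upr; move: (ito m n al) (ito m.-1 n al) (ito m n.-1 al) => x y z.
by ring.
Qed.

Definition plane_wave (u v : R) (z : R * R) : R[i] := cis (- (u * z.1 + v * z.2)).

Definition wigner_wave u v m n (z : R * R) : R[i] :=
  plane_wave u v z * wigner_basis m n z.1 z.2.

(** The derivative of the integrand of the Fourier transform in the direction
    [(dq, dp)]. *)
Definition wigner_wave_dir u v m n (dq dp : R) (z : R * R) : R[i] :=
  - 'i%C * (u * dq + v * dp)%:C * wigner_wave u v m n z +
  (phase_point dq dp * lower_r (fun i j => wigner_wave u v i j z) m n +
   conjc (phase_point dq dp) * lower_l (fun i j => wigner_wave u v i j z) m n).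

Lemma is_cderive_wigner_wave u v m n (fq fp : R -> R) (s dq dp : R) :
  is_derive s 1 fq dq -> is_derive s 1 fp dp ->
  is_cderive (fun t => wigner_wave u v m n (fq t, fp t)) s
    (wigner_wave_dir u v m n dq dp (fq s, fp s)).
Proof.
move=> hq hp.
have h : is_derive s 1 (fun t => - (u * fq t + v * fp t)) (- (u * dq + v * dp)).
  by apply: is_derive_eq; rewrite /GRing.scale/=; ring.
apply: (is_cderive_eq (is_cderiveM (is_cderive_cis_comp h)
  (is_cderive_wigner_basis m n hq hp))).
rewrite /wigner_wave_dir /wigner_wave /plane_wave /lower_l /lower_r /= rmorphN/=.
set x := (u * dq + v * dp)%:C; ring.
Qed.

Lemma normc_wigner_wave u v m n (z : R * R) :
  normc (wigner_wave u v m n z) = normc (wigner_basis m n z.1 z.2).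
Proof. by rewrite normcM normc_cis mul1r. Qed.

Lemma wigner_basis_gauss_bound m n : exists2 C : R, 0 <= C & forall q p : R,
  normc (wigner_basis m n q p) <= C * expR (- (2^-1 * (q ^+ 2 + p ^+ 2))).
Proof.
have t01 : 0 < (2^-1 : R) < 1 by lra.
exists (normc (wigner_vacuum R) * (1 - 2^-1 ^+ 2)^-1 * 2^-1^-1 ^+ (m + n)).
  rewrite !mulr_ge0 ?normc_ge0 ?exprn_ge0 ?invr_ge0 ?invrK// subr_ge0 expr2; lra.
move=> q p; apply: (le_trans (wigner_basis_decay m n q p t01)).
rewrite ler_wpM2l//.
  rewrite !mulr_ge0 ?normc_ge0 ?exprn_ge0 ?invr_ge0 ?invrK// subr_ge0 expr2; lra.
rewrite ler_expR lerN2 ler_wpM2r ?addr_ge0 ?sqr_ge0//.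
by rewrite ler_pdivlMr expr2; lra.
Qed.

Lemma cmeasurable_phase : cmeasurable (fun z : R * R => phase_point z.1 z.2).
Proof.
rewrite /phase_point; apply: cmeasurableM; first exact: cmeasurable_cst.
by split => /=; [exact: measurable_fst|exact: measurable_snd].
Qed.

Lemma cmeasurable_wigner_basis m n :
  cmeasurable (fun z : R * R => wigner_basis m n z.1 z.2).
Proof.
under eq_fun do rewrite wigner_basisE.
apply: cmeasurableM; first exact: cmeasurable_cst.
apply: cmeasurableM; first exact: cmeasurable_ito cmeasurable_phase.
apply: cmeasurable_real; apply: measurableT_comp => //; apply: measurable_funN.
by apply: measurable_funD; apply: measurable_funX.
Qed.

Lemma cmeasurable_plane_wave u v : cmeasurable (plane_wave u v).
Proof.
apply: cmeasurable_cis; apply: measurable_funN.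
by apply: measurable_funD; apply: measurable_funM.
Qed.

Lemma cintegrable_wigner_wave u v m n : cintegrable mu2 (wigner_wave u v m n).
Proof.
have [C C0 HC] := wigner_basis_gauss_bound m n.
have h2 : 0 < (2^-1 : R) by rewrite invr_gt0.
have [m1 m2] : cmeasurable (wigner_wave u v m n).
  by apply: cmeasurableM; [exact: cmeasurable_plane_wave|exact:
      cmeasurable_wigner_basis].
apply: (@cintegrable_dominated _ _ _ mu2 _
  (fun z => C * expR (- (2^-1 * (z.1 ^+ 2 + z.2 ^+ 2))))) => [| | |z].
- exact: m1.
- exact: m2.
- exact: integrable_gauss2.
by rewrite normc_wigner_wave.
Qed.

(** Domination only asks that the path be, at time [s], at distance at least [s]
    from the origin. *)
Lemma tame_wigner_wave u v m n (fq fp : R -> R) (dq dp : R) :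
  (forall s : R, is_derive s 1 fq dq) -> (forall s : R, is_derive s 1 fp dp) ->
  (forall s, s ^+ 2 <= fq s ^+ 2 + fp s ^+ 2) ->
  tame (fun t => wigner_wave u v m n (fq t, fp t)).
Proof.
move=> hq hp hle; split.
  exact: is_cderive_continuous (fun s => is_cderive_wigner_wave u v m n (hq s) (hp s)).
have [C C0 HC] := wigner_basis_gauss_bound m n.
exists C, 2^-1; split => [|s]; first by rewrite invr_gt0.
rewrite normc_wigner_wave (le_trans (HC _ _))// ler_wpM2l// ler_expR lerN2.
by rewrite ler_wpM2l ?invr_ge0.
Qed.

End PlaneFourier.

Section WignerHat.
Variable R : realType.
Local Notation mu := (@lebesgue_measure R).
Local Notation mu2 := (mu \x mu)%E.

Definition wigner_hat u v m n : R[i] := cintegral mu2 (wigner_wave u v m n).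

Lemma cintegrable_lin u v (a : R[i]) m n :
  cintegrable mu2 (fun z => a * wigner_wave u v m n z).
Proof. exact: cintegrableZ (cintegrable_wigner_wave u v m n). Qed.

Lemma wigner_wave_dirE u v m n dq dp (z : R * R) :
  wigner_wave_dir u v m n dq dp z =
  - 'i%C * (u * dq + v * dp)%:C * wigner_wave u v m n z +
  phase_point dq dp * sqn R n * wigner_wave u v m n.-1 z +
  - (phase_point dq dp * sqn R m.+1) * wigner_wave u v m.+1 n z +
  conjc (phase_point dq dp) * sqn R m * wigner_wave u v m.-1 n z +
  - (conjc (phase_point dq dp) * sqn R n.+1) * wigner_wave u v m n.+1 z.
Proof.
rewrite /wigner_wave_dir /lower_r /lower_l.
move: (wigner_wave u v) (conjc (phase_point dq dp)) (phase_point dq dp).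
by move=> w a b; ring.
Qed.

Lemma cintegrable_wave_dir u v m n dq dp :
  cintegrable mu2 (wigner_wave_dir u v m n dq dp).
Proof.
have L := cintegrable_lin u v.
rewrite (funext (wigner_wave_dirE u v m n dq dp)).
exact: (cintegrableD (cintegrableD (cintegrableD (cintegrableD
  (L _ _ _) (L _ _ _)) (L _ _ _)) (L _ _ _)) (L _ _ _)).
Qed.

Lemma cintegral_wave_dir u v m n dq dp :
  cintegral mu2 (wigner_wave_dir u v m n dq dp) =
  - 'i%C * (u * dq + v * dp)%:C * wigner_hat u v m n +
  (phase_point dq dp * lower_r (wigner_hat u v) m n +
   conjc (phase_point dq dp) * lower_l (wigner_hat u v) m n).
Proof.
have L := cintegrable_lin u v; have W := cintegrable_wigner_wave u v.
rewrite (funext (wigner_wave_dirE u v m n dq dp)).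
have I2 a b i j k l := cintegrableD (L a i j) (L b k l).
have I3 a b c i j k l i' j' := cintegrableD (I2 a b i j k l) (L c i' j').
have I4 a b c e i j k l i' j' k' l' :=
  cintegrableD (I3 a b c i j k l i' j') (L e k' l').
rewrite (cintegralD (I4 _ _ _ _ _ _ _ _ _ _ _ _) (L _ _ _)).
rewrite (cintegralD (I3 _ _ _ _ _ _ _ _ _) (L _ _ _)).
rewrite (cintegralD (I2 _ _ _ _ _ _) (L _ _ _)).
rewrite (cintegralD (L _ _ _) (L _ _ _)).
have Z a i j : cintegral mu2 (fun z => a * wigner_wave u v i j z) =
    a * wigner_hat u v i j := cintegralZ a (W i j).
rewrite !Z /lower_r /lower_l; move: (wigner_hat u v) => w; ring.
Qed.

Lemma tame_wave_dir u v m n dq dp (g : R -> R * R) :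
  (forall i j, tame (fun t => wigner_wave u v i j (g t))) ->
  tame (fun t => wigner_wave_dir u v m n dq dp (g t)).
Proof.
move=> N.
rewrite (funext (fun t => wigner_wave_dirE u v m n dq dp (g t))).
by do 4 (apply: tameD; last exact: tameZ); exact: tameZ.
Qed.

Lemma cintegral_cst0 d (T : measurableType d) (nu : {measure set T -> \bar R}) :
  cintegral nu (fun=> 0 : R[i]) = 0.
Proof. by rewrite /cintegral /= Rintegral_cst// mul0r. Qed.

Lemma cintegral_wave_dq u v m n : cintegral mu2 (wigner_wave_dir u v m n 1 0) = 0.
Proof.
have N p i j : tame (fun t => wigner_wave u v i j (t, p)).
  apply: (@tame_wigner_wave _ u v i j id (fun=> p) 1 0) => s.
  by rewrite lerDl sqr_ge0.
rewrite (cintegral_prod21 (cintegrable_wave_dir _ _ _ _ _ _)); last first.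
  move=> p; apply: tame_integrable.
  exact: (@tame_wave_dir u v m n 1 0 (fun t => (t, p)) (N p)).
rewrite (_ : (fun y => _) = (fun=> 0)); first exact: cintegral_cst0.
apply/funext => p.
apply: (@cintegral_derive_eq0 _ (fun t => wigner_wave u v m n (t, p))
  (fun t => wigner_wave_dir u v m n 1 0 (t, p)) _ (N p m n)
  (@tame_wave_dir u v m n 1 0 (fun t => (t, p)) (N p))) => t.
exact: (@is_cderive_wigner_wave _ u v m n id (fun=> p) t 1 0).
Qed.

Lemma cintegral_wave_dp u v m n : cintegral mu2 (wigner_wave_dir u v m n 0 1) = 0.
Proof.
have N q i j : tame (fun t => wigner_wave u v i j (q, t)).
  apply: (@tame_wigner_wave _ u v i j (fun=> q) id 0 1) => s.
  by rewrite lerDr sqr_ge0.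
rewrite (cintegral_prod12 (cintegrable_wave_dir _ _ _ _ _ _)); last first.
  move=> q; apply: tame_integrable.
  exact: (@tame_wave_dir u v m n 0 1 (fun t => (q, t)) (N q)).
rewrite (_ : (fun y => _) = (fun=> 0)); first exact: cintegral_cst0.
apply/funext => q.
apply: (@cintegral_derive_eq0 _ (fun t => wigner_wave u v m n (q, t))
  (fun t => wigner_wave_dir u v m n 0 1 (q, t)) _ (N q m n)
  (@tame_wave_dir u v m n 0 1 (fun t => (q, t)) (N q))) => t.
exact: (@is_cderive_wigner_wave _ u v m n (fun=> q) id t 0 1).
Qed.

Local Notation beta u v := (phase_point (v / 2) (- (u / 2))).

(** Integration by parts in [q] and in [p] turns derivatives into multiplication
    by frequencies.  Solved for the two complex derivatives, this gives again
    raising relations, at the phase point rotated by a right angle and halved. *)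
Lemma lower_hat u v m n :
  lower_r (wigner_hat u v) m n = 2 * conjc (beta u v) * wigner_hat u v m n /\
  lower_l (wigner_hat u v) m n = - (2 * beta u v) * wigner_hat u v m n.
Proof.
have := cintegral_wave_dp u v m n; have := cintegral_wave_dq u v m n.
rewrite !cintegral_wave_dir.
move: (lower_r _ _ _) (lower_l _ _ _) (wigner_hat _ _ _ _) => X Y W.
pose k : R[i] := ((Num.sqrt 2)^-1)%:C.
have kk : 2 * k * k = 1.
  rewrite /k -mulrA -rmorphM/= -invfM sqr_sqrt2 -[X in X * _](rmorph_nat
      (real_complex R)).
  by rewrite -rmorphM/= mulfV.
have p10 : phase_point 1 0 = k by rewrite /phase_point -/k mulr1.
have p01 : phase_point 0 1 = k * 'i%C by [].
have c10 : conjc (phase_point 1 0) = k by rewrite p10 conjc_real.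
have c01 : conjc (phase_point 0 1) = - (k * 'i%C).
  rewrite p01; apply/eqP; rewrite eq_complex /= !(mul0r, mulr0, mulr1, subr0,
      addr0, add0r, oppr0, sub0r).
  by rewrite !eqxx.
have b1 : 2 * beta u v = k * (v%:C - 'i%C * u%:C).
  rewrite /phase_point -/k mulrCA; congr (k * _).
  by apply/eqP; rewrite eq_complex/=; apply/andP; split; apply/eqP; field.
have b2 : 2 * conjc (beta u v) = k * (v%:C + 'i%C * u%:C).
  rewrite /phase_point -/k.
  have -> : conjc (k * (v / 2 +i* - (u / 2))) = k * (v / 2 +i* (u / 2)).
    by rewrite rmorphM/= opprK oppr0.
  rewrite mulrCA; congr (k * _).
  by apply/eqP; rewrite eq_complex/=; apply/andP; split; apply/eqP; field.
rewrite c10 c01 p10 p01 b1 b2 !mulr1 !mulr0 add0r addr0 => hq hp.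
have ii : 'i%C * 'i%C = -1 :> R[i] by rewrite -expr2 sqr_i.
(* From here on only I * I = -1 is used. *)
move: ('i%C) ii hq hp => I ii hq hp.
have Xq : k * (X + Y) = I * u%:C * W.
  apply/eqP; rewrite -subr_eq0 -hq; apply/eqP; ring.
have Xp : k * (X - Y) = v%:C * W.
  transitivity (- I * (I * k * X - I * k * Y)).
    by transitivity (- (I * I) * (k * (X - Y))); [rewrite ii; ring|ring].
  have -> : I * k * X - I * k * Y = I * v%:C * W.
    apply/eqP; rewrite -subr_eq0 -hp; apply/eqP; ring.
  by transitivity (- (I * I) * (v%:C * W)); [ring|rewrite ii; ring].
split.
  transitivity (k * (k * (X + Y) + k * (X - Y))); last by rewrite Xq Xp; ring.
  by transitivity (2 * k * k * X); [rewrite kk mul1r|ring].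
transitivity (k * (k * (X + Y) - k * (X - Y))); last by rewrite Xq Xp; ring.
by transitivity (2 * k * k * Y); [rewrite kk mul1r|ring].
Qed.

(** A displacement operator is a displaced parity operator times the parity, whence
    the sign and the half arguments. *)
Lemma wigner_hat_ito u v m n : wigner_hat u v m n =
  (-1) ^+ m * (ito m n (beta u v) * wigner_hat u v 0 0).
Proof.
pose J i j := (-1) ^+ i * wigner_hat u v i j.
have Jr i j : sqn R j.+1 * J i j.+1 = 2 * beta u v * J i j - sqn R i * J i.-1 j.
  have [_] := lower_hat u v i j; rewrite /lower_l /J.
  move: (beta u v) (wigner_hat u v) => b w E.
  have E' : sqn R j.+1 * w i j.+1 = sqn R i * w i.-1 j + 2 * b * w i j.
    transitivity (sqn R i * w i.-1 j - (sqn R i * w i.-1 j - sqn R j.+1 * w i j.+1)).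
      by ring.
    by rewrite E; ring.
  rewrite mulrCA E'; case: i {E E'} => [|i]; first by rewrite sqn0; ring.
  by rewrite exprS [i.+1.-1]/=; ring.
have Jl i : sqn R i.+1 * J i.+1 0 = 2 * conjc (beta u v) * J i 0.
  have [+ _] := lower_hat u v i 0; rewrite /lower_r /J sqn0 mul0r sub0r.
  move: (conjc (beta u v)) (wigner_hat u v) => b w E.
  transitivity ((-1) ^+ i * - (sqn R i.+1 * w i.+1 0)); first by rewrite exprS; ring.
  by rewrite E; ring.
have := ladder_unique Jr Jl m n; rewrite {1}/J.
have -> : J 0 0 = wigner_hat u v 0 0 by rewrite /J expr0 mul1r.
move: (wigner_hat u v m n) (wigner_hat u v 0 0) (ito _ _ _) => x y z <-.
by rewrite mulrA -exprMn mulrNN mulr1 expr1n mul1r.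
Qed.

End WignerHat.

Section HatDecay.
Variable R : realType.
Local Notation mu := (@lebesgue_measure R).
Local Notation mu2 := (mu \x mu)%E.
Local Notation beta u v := (phase_point (v / 2) (- (u / 2))).

Lemma wigner_hat00 (u v : R) : wigner_hat u v 0 0 =
  wigner_vacuum R * gauss_hat 0 ^+ 2 * (expR (- (2 * normc (beta u v) ^+ 2)))%:C.
Proof.
have E z : wigner_wave u v 0 0 z =
    (wigner_vacuum R * gauss_wave (- (u / 2)) z.1) * gauss_wave (- (v / 2)) z.2.
  rewrite /wigner_wave wigner_basisE ito00 mul1r /gauss_wave /plane_wave.
  have -> : (expR (- (z.1 ^+ 2 + z.2 ^+ 2)))%:C =
      (expR (- z.1 ^+ 2))%:C * (expR (- z.2 ^+ 2))%:C :> R[i].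
    by rewrite -rmorphM/= -expRD opprD.
  have -> : cis (- (u * z.1 + v * z.2)) = cis (2 * - (u / 2) * z.1) * cis (2 * - (v
      / 2) * z.2).
    rewrite /cis; apply/eqP; rewrite eq_complex/= -cosD.
    rewrite (_ : 2 * - (u / 2) * z.1 + 2 * - (v / 2) * z.2 = - (u * z.1 + v *
        z.2)); last by field.
    rewrite eqxx/= [X in _ == X]addrC -sinD.
    by rewrite (_ : 2 * - (u / 2) * z.1 + 2 * - (v / 2) * z.2 = - (u * z.1 + v *
        z.2)); last by field.
  ring.
have I := cintegrable_wigner_wave u v 0 0.
rewrite /wigner_hat (cintegral_prod12 I); last first.
  move=> q; rewrite (funext (fun p => E (q, p))).
  exact: (cintegrableZ (wigner_vacuum R * gauss_wave (- (u / 2)) q)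
    (tame_integrable (tame_gauss_wave (- (v / 2))))).
transitivity (cintegral mu (fun q => wigner_vacuum R * gauss_hat (- (v / 2)) *
    gauss_wave (- (u / 2)) q)).
  congr (cintegral _ _); apply/funext => q.
  rewrite (funext (fun p => E (q, p))).
  transitivity (wigner_vacuum R * gauss_wave (- (u / 2)) q * gauss_hat (- (v / 2))).
    exact: (cintegralZ (wigner_vacuum R * gauss_wave (- (u / 2)) q)
      (tame_integrable (tame_gauss_wave (- (v / 2))))).
  by ring.
transitivity (wigner_vacuum R * gauss_hat (- (v / 2)) * gauss_hat (- (u / 2))).
  exact: (cintegralZ (wigner_vacuum R * gauss_hat (- (v / 2)))
    (tame_integrable (tame_gauss_wave (- (u / 2))))).
rewrite (gauss_hatE (- (u / 2))) (gauss_hatE (- (v / 2))) normc_phase_point.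
have -> : - (2 * (((v / 2) ^+ 2 + (- (u / 2)) ^+ 2) / 2)) = - (- (v / 2)) ^+ 2 + -
    (- (u / 2)) ^+ 2 by field.
rewrite expRD rmorphM/=; ring.
Qed.

Lemma wigner_hat_decay (t : R) m n (u v : R) : 0 < t < 1 ->
  normc (wigner_hat u v m n) <=
  normc (wigner_vacuum R * gauss_hat 0 ^+ 2) * (1 - t ^+ 2)^-1 *
    (t^-1) ^+ (m + n) *
    expR (- ((1 - t ^+ 2) / (1 + t ^+ 2) * ((u / 2) ^+ 2 + (v / 2) ^+ 2))).
Proof.
move=> t01; rewrite wigner_hat_ito wigner_hat00.
have -> : (u / 2) ^+ 2 + (v / 2) ^+ 2 = 2 * normc (beta u v) ^+ 2.
  by rewrite normc_phase_point; field.
have sgn : normc ((-1) ^+ m) = 1 :> R.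
  elim: m => [|m IH]; first by rewrite expr0 complex.ComplexField.Normc.normc1.
  by rewrite exprS normcM IH normcN complex.ComplexField.Normc.normc1 mulr1.
have H := ito_gauss_decay (beta u v) m n t01.
move: (beta u v) H (wigner_vacuum R * _) => b H A.
rewrite normcM sgn mul1r normcM [normc (_ * (expR _)%:C)]normcM normcR.
rewrite ger0_norm ?expR_ge0// mulrCA.
apply: le_trans (ler_wpM2l (normc_ge0 _) H) _.
by rewrite !mulrA.
Qed.

End HatDecay.

(** * Summation against an exponentially decaying density matrix *)

Section SquareSums.
Variable R : realType.
Implicit Types (theta K : R).

Lemma geom_sum_le (theta : R) N : 0 < theta < 1 ->
  \sum_(m < N) theta ^+ m <= (1 - theta)^-1.
Proof.
move=> /andP[t0 t1].
have := @geometric_le_lim R N 1 theta ler01 t0.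
rewrite ger0_norm ?(ltW t0)// => /(_ t1); rewrite div1r; apply: le_trans.
rewrite /series/= big_mkord le_eqVlt; apply/orP; left; apply/eqP.
by apply: eq_bigr => i _; rewrite mul1r.
Qed.

Lemma square_sum_le (a : nat -> nat -> R[i]) (K theta : R) N : 0 < theta < 1 ->
  0 <= K -> (forall m n, normc (a m n) <= K * theta ^+ (m + n)) ->
  normc (\sum_(m < N) \sum_(n < N) a m n) <= K * (1 - theta) ^- 2.
Proof.
move=> t01 K0 aK; have /andP[t0 t1] := t01.
apply: le_trans (normc_sum _ _ _) _.
apply: (@le_trans _ _ (\sum_(m < N) (K * theta ^+ m) * (1 - theta)^-1)).
  apply: ler_sum => m _; apply: le_trans (normc_sum _ _ _) _.
  apply: (@le_trans _ _ (\sum_(n < N) (K * theta ^+ m) * theta ^+ n)).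
    by apply: ler_sum => n _; rewrite -mulrA -exprD.
  rewrite -mulr_sumr ler_wpM2l ?geom_sum_le//.
  by rewrite mulr_ge0// exprn_ge0// ltW.
rewrite -mulr_suml -mulr_sumr -mulrA ler_wpM2l// -exprVn expr2.
by rewrite ler_wpM2r ?geom_sum_le// invr_ge0 subr_ge0 ltW.
Qed.

(** Passing from the square of side [N] to that of side [N + 1] adds one row and
    one column, whose contribution is geometrically small. *)
Lemma square_sum_cvg (x : nat -> nat -> R) (K theta : R) : 0 < theta < 1 ->
  0 <= K -> (forall m n, `|x m n| <= K * theta ^+ (m + n)) ->
  cvgn (fun N => \sum_(m < N) \sum_(n < N) x m n).
Proof.
move=> t01 K0 xK; have /andP[t0 t1] := t01.
pose dlt N := \sum_(m < N) x m N + \sum_(n < N.+1) x N n.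
have -> : (fun N => \sum_(m < N) \sum_(n < N) x m n) = series dlt.
  apply/funext; elim => [|N IH]; first by rewrite /series/= big_ord0 big_geq.
  rewrite /series/= big_nat_recr//= -[X in _ = X + _]/(series dlt N) -IH.
  rewrite big_ord_recr/= /dlt addrA -big_split/=; congr (_ + _).
  by apply: eq_bigr => m _; rewrite big_ord_recr.
apply: normed_cvg.
apply: (@series_le_cvg _ _ (geometric (2 * K * (1 - theta)^-1) theta)).
- by move=> n; exact: normr_ge0.
- move=> n; rewrite /= mulr_ge0 ?exprn_ge0 ?(ltW t0)//.
  by rewrite !mulr_ge0// invr_ge0 subr_ge0 ltW.
- move=> N /=.
  have le1 M (f : nat -> R) : (forall i, `|f i| <= K * theta ^+ (i + N)) ->
      `|\sum_(i < M) f i| <= K * theta ^+ N * (1 - theta)^-1.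
    move=> fK; apply: le_trans (ler_norm_sum _ _ _) _.
    apply: (@le_trans _ _ (\sum_(i < M) K * theta ^+ N * theta ^+ i)).
      by apply: ler_sum => i _; rewrite (le_trans (fK i))// exprD mulrAC mulrA.
    rewrite -mulr_sumr ler_wpM2l ?geom_sum_le//.
    by rewrite mulr_ge0// exprn_ge0// ltW.
  rewrite (le_trans (ler_normD _ _))//.
  rewrite [leRHS](_ : _ = K * theta ^+ N * (1 - theta)^-1 + K * theta ^+ N * (1 -
      theta)^-1); last by ring.
  rewrite lerD//; first exact: (le1 N (fun m => x m N)).
  by apply: le1 => i; rewrite addnC.
- by apply: is_cvg_geometric_series; rewrite ger0_norm// ltW.
Qed.

Lemma Re_sum (I : Type) (r : seq I) (F : I -> R[i]) :
  Re (\sum_(i <- r) F i) = \sum_(i <- r) Re (F i).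
Proof. by elim/big_ind2: _ => // x y z w <- <-; rewrite cReD. Qed.

Lemma Im_sum (I : Type) (r : seq I) (F : I -> R[i]) :
  Im (\sum_(i <- r) F i) = \sum_(i <- r) Im (F i).
Proof. by elim/big_ind2: _ => // x y z w <- <-; rewrite cImD. Qed.

Lemma csum2_cvg (a : nat -> nat -> R[i]) (K theta : R) : 0 < theta < 1 ->
  0 <= K -> (forall m n, normc (a m n) <= K * theta ^+ (m + n)) ->
  (fun N => Re (\sum_(m < N) \sum_(n < N) a m n)) @ \oo --> Re (csum2 a) /\
  (fun N => Im (\sum_(m < N) \sum_(n < N) a m n)) @ \oo --> Im (csum2 a).
Proof.
move=> t01 K0 aK; split.
  have -> : (fun N => Re (\sum_(m < N) \sum_(n < N) a m n)) =
      (fun N => \sum_(m < N) \sum_(n < N) Re (a m n)).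
    by apply/funext => N; rewrite Re_sum; apply: eq_bigr => i _; rewrite Re_sum.
  rewrite /csum2 /climn/=.
  have -> : (fun N => Re (\sum_(m < N) \sum_(n < N) a m n)) =
      (fun N => \sum_(m < N) \sum_(n < N) Re (a m n)).
    by apply/funext => N; rewrite Re_sum; apply: eq_bigr => i _; rewrite Re_sum.
  apply: (@square_sum_cvg (fun m n => Re (a m n)) K theta) => // m n.
  by rewrite (le_trans (Re_le_normc _)).
have -> : (fun N => Im (\sum_(m < N) \sum_(n < N) a m n)) =
    (fun N => \sum_(m < N) \sum_(n < N) Im (a m n)).
  by apply/funext => N; rewrite Im_sum; apply: eq_bigr => i _; rewrite Im_sum.
rewrite /csum2 /climn/=.
have -> : (fun N => Im (\sum_(m < N) \sum_(n < N) a m n)) =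
    (fun N => \sum_(m < N) \sum_(n < N) Im (a m n)).
  by apply/funext => N; rewrite Im_sum; apply: eq_bigr => i _; rewrite Im_sum.
apply: (@square_sum_cvg (fun m n => Im (a m n)) K theta) => // m n.
by rewrite (le_trans (Im_le_normc _)).
Qed.

(** The factor 2 comes from treating real and imaginary parts separately. *)
Lemma normc_lim_le (s : nat -> R[i]) (l : R[i]) (C : R) :
  (fun N => Re (s N)) @ \oo --> Re l -> (fun N => Im (s N)) @ \oo --> Im l ->
  (forall N, normc (s N) <= C) -> normc l <= 2 * C.
Proof.
move=> cr ci sC; rewrite (le_trans (normc_le_ReIm _))// -[2]/(1 + 1) mulrDl mul1r.
apply: lerD.
  apply: (cvgr_to_le (cvg_norm cr)); apply: nearW => N /=.
  by rewrite (le_trans (Re_le_normc _)).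
apply: (cvgr_to_le (cvg_norm ci)); apply: nearW => N /=.
by rewrite (le_trans (Im_le_normc _)).
Qed.

End SquareSums.

Section FockState.
Variable R : realType.
Local Notation mu := (@lebesgue_measure R).

Lemma continuous_fock m : continuous (@fock R m).
Proof.
move=> x; apply: differentiable_continuous; apply/derivable1_diffP.
exact: (@ex_derive _ _ _ _ _ _ _ (is_derive_fock m x)).
Qed.

Lemma Lfun2_of_sqr (f : R -> R) : measurable_fun setT f ->
  mu.-integrable setT (EFin \o (fun x => f x ^+ 2)) -> f \in Lfun mu 2%:E.
Proof.
move=> mf /integrableP[_ fi]; rewrite inE; apply/andP; split; rewrite inE//=.
rewrite /finite_norm unlock poweR_lty//; apply: le_lt_trans fi.
rewrite le_eqVlt; apply/orP; left; apply/eqP; apply: eq_integral => x _ /=.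
by rewrite (@powR_mulrn _ _ 2)// normrX.
Qed.

Lemma isL2_fock m : isL2 (fun x : R => (fock m x)%:C).
Proof.
have mf : measurable_fun setT (@fock R m).
  by apply: continuous_measurable_fun; exact: continuous_fock.
split; apply: Lfun2_of_sqr => /=.
- exact: mf.
- have d4 : 0 < (4^-1 : R) < 2^-1 by lra.
  have [C C0 HC] := fock_gauss_bound m d4.
  have h2 : 0 < (2^-1 : R) by rewrite invr_gt0.
  have ig := integrableZl measurableT (C ^+ 2) (integrable_gauss h2).
  apply: (le_integrable measurableT _ _ ig).
    by apply/measurable_EFinP; exact: measurable_funX.
  move=> x _; rewrite /= lee_fin normrX [leRHS]ger0_norm ?mulr_ge0 ?sqr_ge0 ?expR_ge0//.
  have -> : expR (- (2^-1 * x ^+ 2)) = expR (- (4^-1 * x ^+ 2)) ^+ 2.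
    by rewrite -expRM_natl; congr expR; field.
  by rewrite -exprMn ler_pXn2r ?nnegrE// mulr_ge0// expR_ge0.
- exact: measurable_cst.
- apply: (eq_integrable measurableT (fun=> 0%E)); last exact: integrable0.
  by move=> x _; rewrite /= expr0n.
Qed.

(** No integrability is assumed: when one of the two parts is infinite, both sides
    are 0. *)
Lemma RintegralN d (T : measurableType d) (nu : {measure set T -> \bar R})
  (f : T -> R) : \int[nu]_x (- f x) = - \int[nu]_x f x.
Proof.
rewrite /Rintegral integralE [in RHS]integralE.
have -> : (fun x => (- f x)%:E) = (\- (EFin \o f))%E by [].
rewrite funeposN funenegN.
have : (0 <= \int[nu]_x (EFin \o f)^\+ x)%E by exact: integral_ge0.
have : (0 <= \int[nu]_x (EFin \o f)^\- x)%E by exact: integral_ge0.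
rewrite /comp; case: (integral _ _ _) => [a| |] // _; case: (integral _ _ _) => [b|
    |] // _ /=.
- by rewrite opprB.
- by rewrite oppr0.
- by rewrite oppr0.
- by rewrite oppr0.
Qed.

Lemma inner_conj (f g : R -> R[i]) : inner g f = conjc (inner f g).
Proof.
rewrite /inner /cintegral /=.
have -> : (fun x => Re (conjc (g x) * f x)) = (fun x => Re (conjc (f x) * g x)).
  by apply/funext => x; case: (f x) => a b; case: (g x) => c d /=; ring.
have -> : (fun x => Im (conjc (g x) * f x)) = (fun x => - Im (conjc (f x) * g x)).
  by apply/funext => x; case: (f x) => a b; case: (g x) => c d /=; ring.
by rewrite RintegralN.
Qed.

Lemma density_conj (rho : (R -> R[i]) -> (R -> R[i])) m n : quantum_state rho ->
  density rho n m = conjc (density rho m n).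
Proof.
move=> st; exact: (etrans (state_selfadjoint st (isL2_fock n) (isL2_fock m))
  (inner_conj _ _)).
Qed.

(** Selfadjointness transports the bound from the lower triangle to the upper one. *)
Lemma density_bound (rho : (R -> R[i]) -> (R -> R[i])) (B : R) : quantum_state rho ->
  (forall m n : nat, (n <= m)%N ->
     normc (density rho m n) <= expR (- B * (m + n)%:R)) ->
  forall m n, normc (density rho m n) <= expR (- B) ^+ (m + n).
Proof.
move=> st H m n; rewrite -expRM_natl mulrC.
have [nm|mn] := leqP n m; first exact: H.
by rewrite (density_conj n m st) normc_conj addnC H// ltnW.
Qed.

(** The available rate [B / (1 + B)] exceeds the one required, so any constant is
    eventually beaten by the exponential of the difference; of the prefactor
    only its quadratic term is used. *)
Lemma exp_prefactor_le (B C : R) : 0 < B -> 0 <= C ->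
  exists z1 : R, forall y, z1 <= y ->
   C * expR (- (B / (1 + B) * y ^+ 2)) <=
   wigner_prefactor B y * expR (- (B / (1 + Num.sqrt B) ^+ 2) * y ^+ 2).
Proof.
move=> B0 C0.
have s0 : 0 < Num.sqrt B by rewrite sqrtr_gt0.
have s1 : 0 < 1 + Num.sqrt B by rewrite addr_gt0.
pose A0 := pi^-1 * (2 * expR B / (B * (1 + Num.sqrt B) ^+ 2)).
have A00 : 0 < A0.
  by rewrite mulr_gt0 ?invr_gt0 ?pi_gt0// divr_gt0 ?mulr_gt0 ?expR_gt0 ?exprn_gt0.
have prefA y : A0 * y ^+ 2 <= wigner_prefactor B y.
  rewrite /A0 -mulrA ler_wpM2l ?invr_ge0 ?pi_ge0// lerDr.
  by apply: fine_ge0; apply: esum_ge0 => k _; rewrite lee_fin expR_ge0.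
(* The gain in the exponential rate. *)
pose del := B / (1 + B) - B / (1 + Num.sqrt B) ^+ 2.
have del0 : 0 < del.
  rewrite subr_gt0 ltr_pM2l// ltf_pV2 ?posrE ?exprn_gt0 ?addr_gt0//.
  by rewrite sqrrD expr1n sqr_sqrtr ?ltW// mul1r -addrA ltrD2l ltrDr mulrn_wgt0.
exists (Num.max 1 (C / (A0 * del))) => y; rewrite ge_max => /andP[y1 yC].
have y0 : 0 < y by apply: lt_le_trans y1.
have -> : - (B / (1 + B) * y ^+ 2) = - (del * y ^+ 2) + (- (B / (1 + Num.sqrt B) ^+
    2) * y ^+ 2).
  by rewrite /del; ring.
rewrite expRD mulrA ler_wpM2r ?expR_ge0// (le_trans _ (prefA y))//.
rewrite expRN ler_pdivrMr ?expR_gt0//.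
have Ad : 0 < A0 * del by exact: mulr_gt0.
have C1 : C <= A0 * del * y.
  by move: yC; rewrite (ler_pdivrMr _ _ Ad) [y * _]mulrC.
have e1 : del * y ^+ 2 <= expR (del * y ^+ 2).
  by rewrite (le_trans _ (expR_ge1Dx _))// lerDr.
apply: (@le_trans _ _ (A0 * y ^+ 2 * (del * y ^+ 2))); last first.
  by rewrite ler_wpM2l// mulr_ge0 ?sqr_ge0 ?ltW.
rewrite (le_trans C1)// [leRHS](_ : _ = A0 * del * (y * y ^+ 3)); last by ring.
apply: ler_wpM2l; first exact: ltW.
by rewrite ler_peMr ?exprn_ege1// ltW.
Qed.

End FockState.

Section CDominated.
Variables (R : realType) (d : measure_display) (T : measurableType d).
Variable mu : {measure set T -> \bar R}.

Lemma Rintegral_dominated_cvg (f_ : nat -> T -> R) (f h : T -> R) :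
  (forall n, measurable_fun setT (f_ n)) ->
  mu.-integrable setT (EFin \o h) -> (forall n x, `|f_ n x| <= h x) ->
  (forall x, f_ n x @[n --> \oo] --> f x) ->
  \int[mu]_x f_ n x @[n --> \oo] --> \int[mu]_x f x.
Proof.
move=> mf ih fh cf.
have mlim : measurable_fun setT f.
  by apply: (@measurable_fun_cvg _ _ _ _ f_) => // x _; exact: cf.
have cE x : (f_ n x)%:E @[n --> \oo] --> (f x)%:E.
  by apply/cvg_EFin; [exact: nearW|exact: cf].
have [| | | | |i _ c] := @dominated_convergence _ _ _ mu setT measurableT
  (fun n x => (f_ n x)%:E) (EFin \o f) (EFin \o h).
- by move=> n; exact/measurable_EFinP.
- exact/measurable_EFinP.
- by apply: aeW => x _; exact: cE.
- exact: ih.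
- by apply: aeW => x n _; rewrite /= lee_fin.
apply: fine_cvg; rewrite fineK//.
exact: integrable_fin_num.
Qed.

Lemma cintegral_dominated_cvg (f_ : nat -> T -> R[i]) (f : T -> R[i]) (h : T -> R) :
  (forall n, cintegrable mu (f_ n)) ->
  mu.-integrable setT (EFin \o h) -> (forall n x, normc (f_ n x) <= h x) ->
  (forall x, Re (f_ n x) @[n --> \oo] --> Re (f x)) ->
  (forall x, Im (f_ n x) @[n --> \oo] --> Im (f x)) ->
  Re (cintegral mu (f_ n)) @[n --> \oo] --> Re (cintegral mu f) /\
  Im (cintegral mu (f_ n)) @[n --> \oo] --> Im (cintegral mu f).
Proof.
move=> If ih fh cr ci; split; rewrite /cintegral/=.
  apply: (@Rintegral_dominated_cvg _ _ h) => // n.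
    by have /integrableP[/measurable_EFinP] := (If n).1.
  by move=> x; rewrite (le_trans (Re_le_normc _)).
apply: (@Rintegral_dominated_cvg _ _ h) => // n.
  by have /integrableP[/measurable_EFinP] := (If n).2.
by move=> x; rewrite (le_trans (Im_le_normc _)).
Qed.

Lemma cintegral_sum (N : nat) (F : nat -> T -> R[i]) :
  (forall i, cintegrable mu (F i)) ->
  cintegrable mu (fun x => \sum_(i < N) F i x) /\
  cintegral mu (fun x => \sum_(i < N) F i x) = \sum_(i < N) cintegral mu (F i).
Proof.
move=> IF; elim: N => [|N [I1 E1]].
  under eq_fun do rewrite big_ord0.
  split; last by rewrite big_ord0 cintegral_cst0.
  by split; exact: integrable0.
under eq_fun do rewrite big_ord_recr/=; split; first exact: cintegrableD.
by rewrite cintegralD// E1 big_ord_recr.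
Qed.

End CDominated.

Section Main.
Variable R : realType.
Local Notation mu := (@lebesgue_measure R).
Local Notation mu2 := (mu \x mu)%E.
Variables (rho : (R -> R[i]) -> (R -> R[i])) (theta K c : R).
Hypothesis theta01 : 0 < theta < 1.
Hypothesis K0 : 0 <= K.
Hypothesis c0 : 0 < c.
Hypothesis basis_bound : forall m n q p,
  normc (density rho m n * wigner_basis m n q p) <=
    K * expR (- (c * (q ^+ 2 + p ^+ 2))) * theta ^+ (m + n).
Hypothesis hat_bound : forall m n u v,
  normc (density rho m n * wigner_hat u v m n) <=
    K * expR (- (c * ((u / 2) ^+ 2 + (v / 2) ^+ 2))) * theta ^+ (m + n).

Let Kexp_ge0 x : 0 <= K * expR x.
Proof. by rewrite mulr_ge0// expR_ge0. Qed.

Lemma wigner_decay q p : normc (wigner rho q p) <=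
  2 * (K * (1 - theta) ^- 2) * expR (- (c * (q ^+ 2 + p ^+ 2))).
Proof.
have [cr ci] := csum2_cvg theta01 (Kexp_ge0 _) (fun m n => basis_bound m n q p).
have := normc_lim_le cr ci (fun N => square_sum_le N theta01 (Kexp_ge0 _) (fun m n
    => basis_bound m n q p)).
by congr (_ <= _); ring.
Qed.

(** The double series is exchanged with the integral by dominated convergence of
    its square partial sums, after which the bounds on the individual transforms
    are summed. *)
Lemma wigner_fourier_decay u v : normc (wigner_fourier rho u v) <=
  2 * (K * (1 - theta) ^- 2) * expR (- (c * ((u / 2) ^+ 2 + (v / 2) ^+ 2))).
Proof.
pose f_ N (z : R * R) := \sum_(m < N) \sum_(n < N) density rho m n * wigner_wave u
    v m n z.
have fE N z : f_ N z = plane_wave u v z *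
    \sum_(m < N) \sum_(n < N) density rho m n * wigner_basis m n z.1 z.2.
  rewrite mulr_sumr; apply: eq_bigr => m _; rewrite mulr_sumr; apply: eq_bigr => n _.
  by rewrite /wigner_wave mulrCA.
have IW m n : cintegrable mu2 (fun z => density rho m n * wigner_wave u v m n z).
  exact: cintegrable_lin.
have IS N m := cintegral_sum N (IW m).
have [f_int f_val] : (forall N, cintegrable mu2 (f_ N)) /\
   (forall N, cintegral mu2 (f_ N) = \sum_(m < N) \sum_(n < N) density rho m n *
       wigner_hat u v m n).
  split=> N; have [I1 E1] := cintegral_sum N (fun m => (IS N m).1); first exact: I1.
  rewrite /f_ E1; apply: eq_bigr => m _; rewrite (IS N m).2; apply: eq_bigr => n _.
  exact: (cintegralZ _ (cintegrable_wigner_wave u v m n)).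
have f_le N z : normc (f_ N z) <= K * (1 - theta) ^- 2 * expR (- (c * (z.1 ^+ 2 +
    z.2 ^+ 2))).
  rewrite fE normcM normc_cis mul1r.
  have := square_sum_le N theta01 (Kexp_ge0 _) (fun m n => basis_bound m n z.1 z.2).
  by congr (_ <= _); ring.
have lim z := csum2_cvg theta01 (Kexp_ge0 _) (fun m n => basis_bound m n z.1 z.2).
have [cr ci] : Re (cintegral mu2 (f_ N)) @[N --> \oo] --> Re (wigner_fourier rho u v) /\
    Im (cintegral mu2 (f_ N)) @[N --> \oo] --> Im (wigner_fourier rho u v).
  apply: (@cintegral_dominated_cvg _ _ _ mu2 f_ _
    (fun z => K * (1 - theta) ^- 2 * expR (- (c * (z.1 ^+ 2 + z.2 ^+ 2)))) f_int
    (integrable_gauss2 _ c0) f_le) => z.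
    under eq_fun do rewrite fE cReM; rewrite cReM.
    by apply: cvgB; apply: cvgMr; [exact: (lim z).1|exact: (lim z).2].
  under eq_fun do rewrite fE cImM; rewrite cImM.
  by apply: cvgD; apply: cvgMr; [exact: (lim z).2|exact: (lim z).1].
have := normc_lim_le cr ci (C := K * (1 - theta) ^- 2 * expR (- (c * ((u / 2) ^+ 2
    + (v / 2) ^+ 2)))).
rewrite mulrA => -> // N; rewrite f_val.
have := square_sum_le N theta01 (Kexp_ge0 _) (fun m n => hat_bound m n u v).
by congr (_ <= _); ring.
Qed.

End Main.

Theorem proposition2 (R : realType) (rho : (R -> R[i]) -> (R -> R[i])) (B : R) :
  quantum_state rho ->
  0 < B ->
  (forall m n : nat, (n <= m)%N ->
     normc (density rho m n) <= expR (- B * (m + n)%:R)) ->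
  exists z0 : R, forall q p : R,
    let z := Num.sqrt (q ^+ 2 + p ^+ 2) in
    z0 <= z ->
    normc (wigner rho q p) <=
      wigner_prefactor B z *
        expR (- (B / (1 + Num.sqrt B) ^+ 2) * z ^+ 2)
    /\
    normc (wigner_fourier rho q p) <=
      wigner_prefactor B (z / 2) *
        expR (- (B / (1 + Num.sqrt B) ^+ 2) * (z / 2) ^+ 2).
Proof.
move=> st B0 rhoB.
have b1 : 1 < 1 + 2 * B by rewrite ltrDl mulr_gt0.
have b0 : 0 < 1 + 2 * B by apply: lt_trans b1.
(* At t ^+ 2 = (1 + 2 B)^-1 the rate (1 - t ^+ 2) / (1 + t ^+ 2) is
     B / (1 + B), while e^{-B} / t < 1 because 1 + 2 B < e^{2 B}. *)
pose t := (Num.sqrt (1 + 2 * B))^-1.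
have sb1 : 1 < Num.sqrt (1 + 2 * B) by rewrite -[ltLHS]sqrtr1 ltr_sqrt.
have t01 : 0 < t < 1.
  by rewrite invr_gt0 sqrtr_gt0 b0/= invf_lt1// sqrtr_gt0.
have t2 : t ^+ 2 = (1 + 2 * B)^-1 by rewrite exprVn sqr_sqrtr ?ltW.
have cE : (1 - t ^+ 2) / (1 + t ^+ 2) = B / (1 + B).
  by rewrite t2; field; rewrite !gt_eqF//; lra.
pose theta := expR (- B) * t^-1.
have theta01 : 0 < theta < 1.
  have ti0 : 0 < t^-1 by rewrite invrK sqrtr_gt0.
  rewrite mulr_gt0 ?expR_gt0//=.
  rewrite -(@ltr_pXn2r _ 2) ?nnegrE ?mulr_ge0 ?expR_ge0 ?invrK ?sqrtr_ge0//.
  rewrite /theta exprMn invrK sqr_sqrtr ?(ltW b0)// expr1n -expRM_natl.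
  by rewrite mulrN expRN mulrC ltr_pdivrMr ?expR_gt0// mul1r expR_gt1Dx// gt_eqF//
      mulr_gt0.
pose K1 := normc (wigner_vacuum R) * (1 - t ^+ 2)^-1.
pose K2 := normc (wigner_vacuum R * gauss_hat 0 ^+ 2) * (1 - t ^+ 2)^-1.
have u0 : 0 <= (1 - t ^+ 2)^-1.
  by rewrite invr_ge0 subr_ge0 t2 invf_le1// ltW.
have K10 : 0 <= K1 by rewrite mulr_ge0 ?normc_ge0.
have K20 : 0 <= K2 by rewrite mulr_ge0 ?normc_ge0.
pose K := K1 + K2; have K0 : 0 <= K by rewrite addr_ge0.
pose c := B / (1 + B).
have c0 : 0 < c by rewrite divr_gt0// addr_gt0.
have key (x : R) (k : R) (Q : R) (m n : nat) : 0 <= k <= K ->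
    x <= k * (t^-1) ^+ (m + n) * expR (- (c * Q)) ->
    expR (- B) ^+ (m + n) * x <= K * expR (- (c * Q)) * theta ^+ (m + n).
  move=> /andP[k0 kK] xk.
  have tn : 0 <= t^-1 ^+ (m + n) by rewrite exprn_ge0// invrK sqrtr_ge0.
  rewrite exprMn.
  apply: (le_trans (ler_wpM2l (exprn_ge0 _ (expR_ge0 _)) xk)).
  rewrite [leLHS](_ : _ = k * (expR (- (c * Q)) * (expR (- B) ^+ (m + n) * t^-1 ^+
      (m + n)))); last by ring.
  rewrite -[leRHS]mulrA; apply: ler_wpM2r => //.
  by apply: mulr_ge0; [exact: expR_ge0|apply: mulr_ge0 => //; rewrite exprn_ge0
      ?expR_ge0].
have dens := density_bound st rhoB.
have basis_bound m n q p : normc (density rho m n * wigner_basis m n q p) <=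
    K * expR (- (c * (q ^+ 2 + p ^+ 2))) * theta ^+ (m + n).
  rewrite normcM; apply: le_trans (ler_wpM2r (normc_ge0 _) (dens m n)) _.
  apply: (key _ K1); first by rewrite K10 lerDl.
  by have := wigner_basis_decay m n q p t01; rewrite cE.
have hat_bound m n u v : normc (density rho m n * wigner_hat u v m n) <=
    K * expR (- (c * ((u / 2) ^+ 2 + (v / 2) ^+ 2))) * theta ^+ (m + n).
  rewrite normcM; apply: le_trans (ler_wpM2r (normc_ge0 _) (dens m n)) _.
  apply: (key _ K2); first by rewrite K20 lerDr.
  by have := wigner_hat_decay m n u v t01; rewrite cE.
have C0 : 0 <= 2 * (K * (1 - theta) ^- 2).
  by rewrite !mulr_ge0// invr_ge0 sqr_ge0.
have [z1 Hz1] := exp_prefactor_le B0 C0.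
(* The Fourier transform is bounded at z / 2, which has to exceed z1 as well. *)
exists (Num.max z1 (2 * z1)); move=> q p z.
rewrite ge_max => /andP[z1z z2z].
have zz : z ^+ 2 = q ^+ 2 + p ^+ 2 by rewrite sqr_sqrtr// addr_ge0 ?sqr_ge0.
split.
  apply: le_trans (Hz1 z z1z); rewrite zz.
  exact: wigner_decay theta01 K0 basis_bound q p.
apply: le_trans (Hz1 (z / 2) _); last by rewrite ler_pdivlMr// mulrC.
have -> : (z / 2) ^+ 2 = (q / 2) ^+ 2 + (p / 2) ^+ 2.
  by rewrite !expr_div_n zz mulrDl.
exact: wigner_fourier_decay theta01 K0 c0 basis_bound hat_bound q p.
Qed.
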